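(* Let $(M,g)$ be a spacetime of dimension $n\ge 3$ and let $\gamma$ be a timelike geodesic in $(M,g)$ parametrized by proper time $\tau$, defined on an open interval $I\subseteq\mathbb{R}$. Let $\xi\in[0,2\xi_c]$, where $\xi_c=\frac{n-2}{4(n-1)}$, and let $\phi$ be a smooth real-valued solution of $(\Box_g+m^2+\xi R)\phi=0$ on $M$. Let $T_{\mu\nu}$ be the stress-energy tensor of $\phi$ with coupling constant $\xi$ and let $\rho=T_{\mu\nu}\dot\gamma^\mu\dot\gamma^\nu-\frac{1}{n-2}T$ be the effective energy density along $\gamma$. Then for every real-valued $f\in C^2_0(\mathbb{R})$ (twice continuously differentiable with compact support) with support contained in $I$, $$\int_\gamma d\tau\,\rho\,f^2(\tau)\ \ge\ -\int_\gamma d\tau\,\Big\{\frac{1-2\xi}{n-2}\,m^2 f^2(\tau)+\xi\Big(2(f'(\tau))^2+R_{\mu\nu}\dot\gamma^\mu\dot\gamma^\nu f^2(\tau)-\frac{2\xi}{n-2}R\,f^2(\tau)\Big)\Big\}\phi^2 ,$$ where $\phi$, $R_{\mu\nu}$ and $R$ are evaluated along $\gamma$.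
   Context: Conventions: the metric $g$ is smooth and Lorentzian with signature $(+,-,\dots,-)$; the sign conventions are $[-,-,-]$ of Misner–Thorne–Wheeler, so $R_{\mu\nu}$ is minus the usual Ricci tensor (the usual one, $\mathrm{Ric}$, satisfies $(\nabla_\nu\nabla_\mu-\nabla_\mu\nabla_\nu)V^\nu=\mathrm{Ric}_{\mu\sigma}V^\sigma$), i.e. $R_{\mu\nu}=-\mathrm{Ric}_{\mu\nu}$. The Ricci scalar is $R=g^{\mu\nu}R_{\mu\nu}$, the Einstein tensor is $G_{\mu\nu}=R_{\mu\nu}-\tfrac12 R g_{\mu\nu}$, and $\Box_g=g^{\mu\nu}\nabla_\mu\nabla_\nu$. The mass $m\ge 0$ is a constant. Units are $G=c=1$. The stress-energy tensor of the nonminimally coupled scalar field with coupling constant $\xi$ is $$T_{\mu\nu}=(\nabla_\mu\phi)(\nabla_\nu\phi)+\tfrac12 g_{\mu\nu}\big(m^2\phi^2-(\nabla\phi)^2\big)+\xi\,(g_{\mu\nu}\Box_g-\nabla_\mu\nabla_\nu-G_{\mu\nu})\phi^2 ,$$ where $(\nabla\phi)^2=g^{\mu\nu}(\nabla_\mu\phi)(\nabla_\nu\phi)$, the differential operators act on $\phi^2$, and $T=g^{\mu\nu}T_{\mu\nu}$. *)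

(* Defs.v *)
From HB Require Import structures.
From mathcomp Require Import all_boot all_order all_algebra.
From mathcomp Require Import all_classical all_reals all_analysis.

Set Implicit Arguments.
Unset Strict Implicit.
Unset Printing Implicit Defensive.

Import Order.TTheory GRing.Theory Num.Theory.
Import numFieldNormedType.Exports.

Local Open Scope classical_set_scope.
Local Open Scope ring_scope.

(* Infinite differentiability on an open set U: every iterated directional
   derivative is (Frechet) differentiable at every point of U.  Values of f
   outside U are irrelevant because U is meant to be open. *)
Definition smooth_on (R : realType) (V W : normedModType R)
    (U : set V) (f : V -> W) : Prop :=
  forall (s : seq V) (x : V), U x ->
    differentiable (foldr (fun v (h : V -> W) => 'D_v h) f s) x.

(* Smooth n-manifold given by a (not necessarily maximal) smooth atlas.
   Charts are total functions, meaningful on chart_dom only; chart_inv is the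
   inverse chart, meaningful on the image of chart_dom only. *)
Record manifold (R : realType) (n : nat) := Manifold {
  carrier :> topologicalType;
  carrier_hausdorff : hausdorff_space carrier;
  carrier_second_countable : @second_countable carrier;
  chart : Type;
  chart_dom : chart -> set carrier;
  chart_map : chart -> carrier -> 'rV[R]_n;
  chart_inv : chart -> 'rV[R]_n -> carrier;
  chart_dom_open : forall c, open (chart_dom c);
  chart_cover : forall p, exists c, chart_dom c p;
  chart_img_open : forall c, open (chart_map c @` chart_dom c);
  chart_mapK : forall c p, chart_dom c p -> chart_inv c (chart_map c p) = p;
  chart_map_continuous : forall c p, chart_dom c p -> {for p, continuous (chart_map c)};
  chart_inv_continuous : forall c p, chart_dom c p ->
    {for chart_map c p, continuous (chart_inv c)};
  chart_compatible : forall c d,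
    smooth_on (chart_map c @` (chart_dom c `&` chart_dom d))
              (chart_map d \o chart_inv c)
}.

Definition chart_img (R : realType) (n : nat) (M : manifold R n) (c : chart M)
  : set 'rV[R]_n := chart_map c @` chart_dom c.

(* Scalars and components at a point are computed in a chosen chart around it;
   for the scalars used below the choice is immaterial. *)
Definition chart_at (R : realType) (n : nat) (M : manifold R n) (p : M)
  : chart M := projT1 (cid (chart_cover p)).

Definition lorentz_sign (R : realType) (n : nat) : 'M[R]_n :=
  diag_mx (\row_(i < n) if (i : nat) == 0%N then 1 else -1).

(* The matrix (g_{ab}) in each chart.  Since [jacobian] acts on row vectors,
   its (a, c) entry is the a-th partial derivative of the
   c-th component. *)
Record lorentz_metric (R : realType) (n : nat) (M : manifold R n) :=
  LorentzMetric {
  metric_mx :> chart M -> 'rV[R]_n -> 'M[R]_n;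
  metric_smooth : forall c a b,
    smooth_on (chart_img c) (fun x => metric_mx c x a b : R^o);
  metric_sym : forall c x, chart_img c x -> (metric_mx c x)^T = metric_mx c x;
  metric_signature : forall c x, chart_img c x ->
    exists2 P : 'M[R]_n, P \in unitmx &
      P *m metric_mx c x *m P^T = lorentz_sign R n;
  metric_transition : forall c d p, chart_dom c p -> chart_dom d p ->
    let J := jacobian (chart_map d \o chart_inv c) (chart_map c p) in
    metric_mx c (chart_map c p) = J *m metric_mx d (chart_map d p) *m J^T
}.

Section Coordinates.
Variables (R : realType) (n : nat).
Local Notation V := 'rV[R]_n.

Definition pd (a : 'I_n) (u : V -> R) (x : V) : R :=
  'D_(delta_mx 0 a) (u : V -> R^o) x.

Variable g : V -> 'M[R]_n.

(* christoffel k a b = Gamma^k_{ab} *)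
Definition christoffel (k a b : 'I_n) (x : V) : R :=
  2^-1 * \sum_(l < n) invmx (g x) k l *
    (pd a (fun y => g y b l) x + pd b (fun y => g y a l) x
     - pd l (fun y => g y a b) x).

(* riemann r s a b = Riem^r_{s a b}, normalised by
   (nabla_a nabla_b - nabla_b nabla_a) V^r = Riem^r_{s a b} V^s *)
Definition riemann (r s a b : 'I_n) (x : V) : R :=
  pd a (christoffel r b s) x - pd b (christoffel r a s) x
  + \sum_(l < n) (christoffel r a l x * christoffel l b s x
                  - christoffel r b l x * christoffel l a s x).

(* [-,-,-] convention: the opposite of the usual contraction
   Ric_{ab} = Riem^r_{a r b} *)
Definition ricci (x : V) : 'M[R]_n :=
  \matrix_(a, b) - \sum_(r < n) riemann r a r b x.

Definition mtrace (S : 'M[R]_n) (x : V) : R :=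
  \sum_(a < n) \sum_(b < n) invmx (g x) a b * S a b.

Definition scalar_curv (x : V) : R := mtrace (ricci x) x.

Definition einstein (x : V) : 'M[R]_n :=
  ricci x - (2^-1 * scalar_curv x) *: g x.

Definition hessian (u : V -> R) (x : V) : 'M[R]_n :=
  \matrix_(a, b) (pd a (pd b u) x
                  - \sum_(k < n) christoffel k a b x * pd k u x).

Definition box (u : V -> R) (x : V) : R := mtrace (hessian u x) x.

Definition dprod (u : V -> R) (x : V) : 'M[R]_n :=
  \matrix_(a, b) (pd a u x * pd b u x).

Definition grad2 (u : V -> R) (x : V) : R := mtrace (dprod u x) x.

Definition stress (m xi : R) (u : V -> R) (x : V) : 'M[R]_n :=
  let u2 := fun y => u y ^+ 2 in
  dprod u x
  + (2^-1 * (m ^+ 2 * u x ^+ 2 - grad2 u x)) *: g x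
  + xi *: (box u2 x *: g x - hessian u2 x - u x ^+ 2 *: einstein x).

End Coordinates.

Definition mx_eval (R : realType) (n : nat) (S : 'M[R]_n) (v : 'rV[R]_n) : R :=
  \sum_(a < n) \sum_(b < n) S a b * v 0 a * v 0 b.

Section Spacetime.
Variables (R : realType) (n : nat) (M : manifold R n) (g : lorentz_metric M).

Definition in_chart (phi : M -> R) (c : chart M) : 'rV[R]_n -> R :=
  phi \o chart_inv c.

Definition smooth_fun (phi : M -> R) : Prop :=
  forall c : chart M, smooth_on (chart_img c) (in_chart phi c : _ -> R^o).

Definition scal (p : M) : R :=
  let c := chart_at p in scalar_curv (g c) (chart_map c p).

Definition wave_op (phi : M -> R) (p : M) : R :=
  let c := chart_at p in box (g c) (in_chart phi c) (chart_map c p).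

Definition field_solution (m xi : R) (phi : M -> R) : Prop :=
  forall p : M, wave_op phi p + (m ^+ 2 + xi * scal p) * phi p = 0.

Definition stress_trace (m xi : R) (phi : M -> R) (p : M) : R :=
  let c := chart_at p in
  mtrace (g c) (stress (g c) m xi (in_chart phi c) (chart_map c p)) (chart_map c p).

Section Curve.
Variables (I : set R) (gamma : R -> M).

Definition velocity (c : chart M) (t : R) : 'rV[R]_n :=
  derive1 (chart_map c \o gamma) t.

Definition smooth_curve : Prop :=
  (forall t, I t -> {for t, continuous gamma}) /\
  (forall c : chart M,
     smooth_on (I `&` gamma @^-1` chart_dom c : set R^o)
               (chart_map c \o gamma : R^o -> 'rV[R]_n)).

Definition geodesic : Prop :=
  smooth_curve /\
  forall (c : chart M) (t : R), I t -> chart_dom c (gamma t) ->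
  forall k : 'I_n,
    derive1 (velocity c) t 0 k
    + mx_eval (\matrix_(a, b) christoffel (g c) k a b (chart_map c (gamma t)))
              (velocity c t) = 0.

(* Timelike with proper-time parameter: g(gamma', gamma') = 1 in signature
   (+,-,...,-). *)
Definition proper_time : Prop :=
  forall (c : chart M) (t : R), I t -> chart_dom c (gamma t) ->
    mx_eval (g c (chart_map c (gamma t))) (velocity c t) = 1.

Definition ricci_along (t : R) : R :=
  let c := chart_at (gamma t) in
  mx_eval (ricci (g c) (chart_map c (gamma t))) (velocity c t).

Definition stress_along (m xi : R) (phi : M -> R) (t : R) : R :=
  let c := chart_at (gamma t) in
  mx_eval (stress (g c) m xi (in_chart phi c) (chart_map c (gamma t)))
          (velocity c t).

Definition eff_density (m xi : R) (phi : M -> R) (t : R) : R :=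
  stress_along m xi phi t - stress_trace m xi phi (gamma t) / (n%:R - 2).

End Curve.
End Spacetime.

Definition conformal_coupling (R : realType) (n : nat) : R :=
  (n%:R - 2) / (4 * (n%:R - 1)).

Definition C2 (R : realType) (f : R -> R) : Prop :=
  [/\ forall t, derivable f t 1,
      forall t, derivable (derive1 f) t 1 &
      continuous (derive1n 2 f)].

Definition tsupport (R : realType) (f : R -> R) : set R :=
  closure [set t | f t != 0].

(* Main.v *)
(* With psi = phi o gamma, the geodesic equation turns the Hessian term of the
   stress tensor into psi'', and the field equation eliminates the d'Alembertian
   of phi, so that

     rho f^2 + {...} phi^2 = f^2 psi'^2 - 2 xi / (n-2) |grad phi|^2 f^2
                             - xi f^2 (psi^2)'' + 2 xi f'^2 psi^2.

   Since gamma' is unit timelike, |grad phi|^2 <= psi'^2 (reverse Cauchy-Schwarz).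
   After adding the exact derivative xi (f^2 (psi^2)')', which integrates to 0,
   the right-hand side is thus at least

     (1 - 2 xi (n-1) / (n-2)) (f psi')^2 + 2 xi ((f psi)')^2,

   which is nonnegative because xi <= 2 xi_c.  The integrands are defined through
   an arbitrary choice of chart at each point of gamma, so their integrability
   rests on the transformation laws of the metric, the Christoffel symbols, the
   curvature and the gradient under a change of chart. *)

From HB Require Import structures.
Require Import Defs.
From mathcomp Require Import all_boot all_order all_algebra.
From mathcomp Require Import all_classical all_reals all_analysis.
From mathcomp Require Import ring lra.
Import Order.TTheory GRing.Theory Num.Theory.
Import numFieldNormedType.Exports.
Local Open Scope classical_set_scope.
Local Open Scope ring_scope.

Set Implicit Arguments.
Unset Strict Implicit.
Unset Printing Implicit Defensive.

(** * Smooth functions *)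

(** [smooth_on] speaks only of iterated directional derivatives, so neither closure under products,
    inverses and composition nor the symmetry of mixed derivatives comes for free; both are
    established before any geometry. The chart chosen at [gamma t] may jump wildly with [t]. The
    formula for the density is therefore derived at each [t] inside that one chart, where the
    geodesic and field equations remove the Hessian and the d'Alembertian; hence no transformation
    law for the Hessian or the stress tensor is required. What survives is [phi \o gamma], which
    involves no chart, and the Ricci term, the scalar curvature and the squared gradient. Near a
    given time each of these equals its expression in a single chart, which gives continuity. The
    laws for the curvature follow from reading the Christoffel symbols as a matrix-valued one-form
    and the Jacobian as a gauge transformation. They are kept in a form multiplied by the Jacobian,
    so that an inverse Jacobian is never differentiated. *)

Lemma near_eq_differentiable (R : realType) (V W : normedModType R)
  (f h : V -> W) (x : V) :
  (\near x, f x = h x) -> differentiable f x -> differentiable h x.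
Proof.
move=> fh /diff_locallyP[dfc dfE].
have hx : h \o shift x = cst (h x) + 'd f x +o_ 0 id.
  apply/eqaddoP => _/posnumP[e].
  have fh0 : \forall y \near (0 : V), f (y + x) = h (y + x).
    move: fh; rewrite (near_shift 0) /=; by apply: filterS => y /=; rewrite subr0.
  have /eqaddoP /(_ e%:num) /(_ [gt0 of e%:num]) := dfE.
  apply: filterS2 fh0 => y fhy.
  by rewrite -![(_ - _ : _ -> _) _]/(_ - _) -![(_ + _ : _ -> _) _]/(_ + _) /cst /= -fhy -(nbhs_singleton fh).
by apply/diff_locallyP; rewrite (diff_unique dfc hx).
Qed.

Section Smooth.
Variables (R : realType) (V : normedModType R).

Lemma smooth_on_differentiable (W : normedModType R) (U : set V) (f : V -> W) x :
  smooth_on U f -> U x -> differentiable f x.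
Proof. by move=> sf Ux; exact: (sf [::] x Ux). Qed.

Lemma smooth_on_derive (W : normedModType R) (U : set V) (f : V -> W) v :
  smooth_on U f -> smooth_on U ('D_v f).
Proof. by move=> sf s x Ux; have := sf (rcons s v) x Ux; rewrite foldr_rcons. Qed.

Lemma foldr_derive_eq (W : normedModType R) (U : set V) (f h : V -> W) s :
  open U -> {in U, f =1 h} ->
  {in U, foldr (fun v (k : V -> W) => 'D_v k) f s =1
         foldr (fun v (k : V -> W) => 'D_v k) h s}.
Proof.
move=> Uo; elim: s => //= v s IH fh x Ux.
apply: near_eq_derive; apply: filterS (open_nbhs_nbhs (conj Uo (set_mem Ux))).
by move=> y Uy; apply: IH => //; exact/mem_set.
Qed.

(** Coinduction for smoothness: formulas for iterated derivatives grow, so the induction runs over a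
    whole class [P]. Peeling the last direction off the list removes the derivative that is applied
    first, and this one stays in [P] up to equality on the open set. *)
Lemma smooth_on_coind (W : normedModType R) (U : set V) (P : (V -> W) -> Prop) :
  open U ->
  (forall f, P f -> forall x, U x -> differentiable f x) ->
  (forall f v, P f -> exists2 h, P h & {in U, 'D_v f =1 h}) ->
  forall f, P f -> smooth_on U f.
Proof.
move=> Uo Pdiff Pder f Pf s; elim/last_ind: s f Pf => [|s v IH] f Pf x Ux.
  exact: Pdiff.
rewrite foldr_rcons; have [h Ph fh] := Pder f v Pf.
apply: near_eq_differentiable (IH _ Ph x Ux).
apply: filterS (open_nbhs_nbhs (conj Uo Ux)) => y /mem_set Uy.
by rewrite (foldr_derive_eq _ Uo fh).
Qed.

Lemma eq_smooth_on (W : normedModType R) (U : set V) (f h : V -> W) :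
  open U -> {in U, f =1 h} -> smooth_on U f -> smooth_on U h.
Proof.
move=> Uo fh sf s x Ux; apply: near_eq_differentiable (sf s x Ux).
apply: filterS (open_nbhs_nbhs (conj Uo Ux)) => y /mem_set Uy.
exact: (foldr_derive_eq s Uo fh Uy).
Qed.

Lemma smooth_on_cst (U : set V) (W : normedModType R) (a : W) :
  open U -> smooth_on U (fun _ : V => a).
Proof.
move=> Uo; apply: (@smooth_on_coind W U (fun f => exists b, f = cst b)) => //.
- by move=> _ [b ->] x _; exact: differentiable_cst.
- move=> _ v [b ->]; exists (cst 0); first by exists 0.
  by move=> x _; rewrite derive_cst.
- by exists a.
Qed.

End Smooth.

Section SmoothAlgebra.
Variables (R : realType) (V : normedModType R).

Lemma derive_coord n (F : V -> 'rV[R]_n) (x v : V) k : differentiable F x ->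
  'D_v (fun y => F y 0 k : R^o) x = 'D_v F x 0 k.
Proof. by move=> dF; rewrite derive_mx ?mxE//; exact: diff_derivable. Qed.

Lemma smooth_on_coord n (U : set V) (F : V -> 'rV[R]_n) k : open U ->
  smooth_on U F -> smooth_on U (fun y => F y 0 k : R^o).
Proof.
move=> Uo sF.
apply: (@smooth_on_coind _ _ _ U (fun h => exists2 G, smooth_on U G &
  h = (fun y => (G y : 'rV[R]_n) 0 k))) => //; last by exists F.
- move=> _ [G sG ->] x Ux.
  apply: (@differentiable_comp _ _ _ _ G (fun M : 'rV[R]_n => M 0 k : R^o)).
    exact: smooth_on_differentiable sG Ux.
  exact: differentiable_coord.
- move=> _ v [G sG ->]; exists (fun y => 'D_v G y 0 k).
    by exists ('D_v G) => //; exact: smooth_on_derive.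
  move=> x /set_mem Ux; rewrite derive_coord//.
  exact: smooth_on_differentiable sG Ux.
Qed.

Lemma derive_chain n (F : V -> 'rV[R]_n) (u : 'rV[R]_n -> R) (x v : V) :
  differentiable F x -> differentiable (u : _ -> R^o) (F x) ->
  'D_v (fun y => u (F y) : R^o) x =
  \sum_(k < n) 'D_v (fun y => F y 0 k : R^o) x * pd k u (F x).
Proof.
move=> dF du.
rewrite (deriveE v (differentiable_comp dF du)) (diff_comp dF du) /=.
rewrite -(deriveE v dF) [X in 'd _ _ X]row_sum_delta linear_sum.
by apply: eq_bigr => k _; rewrite linearZ /= derive_coord// /pd -(deriveE _ du).
Qed.

Lemma derive_add (f g : V -> R) x v :
  differentiable (f : _ -> R^o) x -> differentiable (g : _ -> R^o) x ->
  'D_v (fun y => f y + g y : R^o) x = 'D_v (f : _ -> R^o) x + 'D_v (g : _ -> R^o) x.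
Proof. by move=> df dg; apply: deriveD; exact: diff_derivable. Qed.

Lemma derive_sub (f g : V -> R) x v :
  differentiable (f : _ -> R^o) x -> differentiable (g : _ -> R^o) x ->
  'D_v (fun y => f y - g y : R^o) x = 'D_v (f : _ -> R^o) x - 'D_v (g : _ -> R^o) x.
Proof. by move=> df dg; apply: deriveB; exact: diff_derivable. Qed.

Lemma derive_mul (f g : V -> R) x v :
  differentiable (f : _ -> R^o) x -> differentiable (g : _ -> R^o) x ->
  'D_v (fun y => f y * g y : R^o) x =
  'D_v (f : _ -> R^o) x * g x + f x * 'D_v (g : _ -> R^o) x.
Proof.
move=> df dg; rewrite [LHS]deriveM; [|exact: diff_derivable..].
by rewrite addrC; congr (_ + _); rewrite mulrC.
Qed.

Lemma derive_bigsum n (f : 'I_n -> V -> R) x v :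
  (forall i, differentiable (f i : _ -> R^o) x) ->
  'D_v (fun y => \sum_i f i y : R^o) x = \sum_i 'D_v (f i : _ -> R^o) x.
Proof.
move=> df; rewrite -derive_sum => [|i]; last exact: diff_derivable.
by congr ('D_v _ x); apply/funext => y; rewrite fct_sumE.
Qed.

(* This class is closed under directional derivatives up to equality on U, so
   [smooth_on_coind] gives all the closure properties of [smooth_on] at once. *)
Inductive smooth_alg (U : set V) : (V -> R) -> Prop :=
| SmoothBase f : smooth_on U (f : _ -> R^o) -> smooth_alg U f
| SmoothAdd f g : smooth_alg U f -> smooth_alg U g ->
    smooth_alg U (fun x => f x + g x)
| SmoothMul f g : smooth_alg U f -> smooth_alg U g ->
    smooth_alg U (fun x => f x * g x)
| SmoothInv f : (forall x, U x -> f x != 0) -> smooth_alg U f ->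
    smooth_alg U (fun x => (f x)^-1)
| SmoothComp n (U' : set 'rV[R]_n) (F : V -> 'rV[R]_n) u :
    smooth_on U' (u : _ -> R^o) -> (forall x, U x -> U' (F x)) ->
    smooth_on U F -> smooth_alg U (fun x => u (F x)).

Lemma smooth_alg_sum (U : set V) I (s : seq I) (f : I -> V -> R) : open U ->
  (forall i, smooth_alg U (f i)) -> smooth_alg U (fun x => \sum_(i <- s) f i x).
Proof.
move=> Uo sf; elim: s => [|i s IH].
  rewrite (_ : (fun _ => _) = fun=> 0); last by apply/funext => x; rewrite big_nil.
  by apply: SmoothBase; exact: smooth_on_cst.
rewrite (_ : (fun _ => _) = fun x => f i x + \sum_(j <- s) f j x).
  exact: SmoothAdd.
by apply/funext => x; rewrite big_cons.
Qed.

Lemma smooth_alg_prod (U : set V) I (s : seq I) (f : I -> V -> R) : open U ->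
  (forall i, smooth_alg U (f i)) -> smooth_alg U (fun x => \prod_(i <- s) f i x).
Proof.
move=> Uo sf; elim: s => [|i s IH].
  rewrite (_ : (fun _ => _) = fun=> 1); last by apply/funext => x; rewrite big_nil.
  by apply: SmoothBase; exact: smooth_on_cst.
rewrite (_ : (fun _ => _) = fun x => f i x * \prod_(j <- s) f j x).
  exact: SmoothMul.
by apply/funext => x; rewrite big_cons.
Qed.

Lemma smooth_alg_cst (U : set V) a : open U -> smooth_alg U (fun=> a).
Proof. by move=> Uo; apply: SmoothBase; exact: smooth_on_cst. Qed.

Lemma smooth_alg_differentiable (U : set V) f : smooth_alg U f ->
  forall x, U x -> differentiable (f : _ -> R^o) x.
Proof.
elim=> {f} [f sf|f g _ IHf _ IHg|f g _ IHf _ IHg|f f0 _ IHf|n U' F u su UU' sF] x Ux.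
- exact: smooth_on_differentiable sf Ux.
- by apply: differentiableD; [exact: IHf|exact: IHg].
- by apply: differentiableM; [exact: IHf|exact: IHg].
- by apply: differentiableV; [exact: IHf|exact: f0].
- apply: (@differentiable_comp _ _ _ _ F (u : _ -> R^o)).
    exact: smooth_on_differentiable sF Ux.
  exact: (smooth_on_differentiable su (UU' _ Ux)).
Qed.

(** The product, quotient and chain rules write every derivative with the same constructors.
    Agreement is claimed on [U] only, since these rules need differentiability of the parts. *)
Lemma smooth_alg_derive (U : set V) f v : open U -> smooth_alg U f ->
  exists2 h, smooth_alg U h & {in U, 'D_v (f : _ -> R^o) =1 h}.
Proof.
move=> Uo; elim=> {f} [f sf|f g sf [f' sf' ff'] sg [g' sg' gg']
  |f g sf [f' sf' ff'] sg [g' sg' gg']|f f0 sf [f' sf' ff']|n U' F u su UU' sF].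
- by exists ('D_v (f : _ -> R^o)) => //; apply: SmoothBase; exact: smooth_on_derive.
- exists (fun x => f' x + g' x); first exact: SmoothAdd.
  move=> x Ux; rewrite /= derive_add ?ff' ?gg'//;
    by [exact: smooth_alg_differentiable sf _ (set_mem Ux)
       |exact: smooth_alg_differentiable sg _ (set_mem Ux)].
- exists (fun x => f' x * g x + f x * g' x).
    by apply: SmoothAdd; exact: SmoothMul.
  move=> x Ux; rewrite /= derive_mul ?ff' ?gg'//;
    by [exact: smooth_alg_differentiable sf _ (set_mem Ux)
       |exact: smooth_alg_differentiable sg _ (set_mem Ux)].
- exists (fun x => -1 * ((f x)^-1 * (f x)^-1) * f' x).
    apply: SmoothMul => //; apply: SmoothMul; first exact: smooth_alg_cst.
    by apply: SmoothMul; exact: SmoothInv.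
  move=> x Ux; rewrite /= deriveV; last 2 first.
  + exact: f0 (set_mem Ux).
  + apply: diff_derivable; exact: smooth_alg_differentiable sf _ (set_mem Ux).
  by rewrite ff'// expr2 invfM mulN1r.
- exists (fun x => \sum_(k < n) 'D_v (fun y => F y 0 k : R^o) x * pd k u (F x)).
    apply: smooth_alg_sum => // k; apply: SmoothMul.
      by apply: SmoothBase; apply: smooth_on_derive; exact: smooth_on_coord.
    by apply: (@SmoothComp _ _ U') => //; exact: smooth_on_derive.
  move=> x /set_mem Ux; rewrite derive_chain//.
    exact: smooth_on_differentiable sF Ux.
  exact: (smooth_on_differentiable su (UU' _ Ux)).
Qed.

Lemma smooth_algP (U : set V) f : open U ->
  smooth_alg U f <-> smooth_on U (f : _ -> R^o).
Proof.
move=> Uo; split; last exact: SmoothBase.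
apply: smooth_on_coind => //; first exact: smooth_alg_differentiable.
by move=> h v; exact: smooth_alg_derive.
Qed.

Lemma smooth_onD (U : set V) (f g : V -> R) : open U ->
  smooth_on U (f : _ -> R^o) -> smooth_on U (g : _ -> R^o) ->
  smooth_on U (fun x => f x + g x : R^o).
Proof. by move=> Uo sf sg; apply/smooth_algP => //; apply: SmoothAdd; exact: SmoothBase. Qed.

Lemma smooth_onM (U : set V) (f g : V -> R) : open U ->
  smooth_on U (f : _ -> R^o) -> smooth_on U (g : _ -> R^o) ->
  smooth_on U (fun x => f x * g x : R^o).
Proof. by move=> Uo sf sg; apply/smooth_algP => //; apply: SmoothMul; exact: SmoothBase. Qed.

Lemma smooth_onN (U : set V) (f : V -> R) : open U ->
  smooth_on U (f : _ -> R^o) -> smooth_on U (fun x => - f x : R^o).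
Proof.
move=> Uo sf; rewrite (_ : (fun _ => _) = fun x => -1 * f x : R^o).
  by apply: smooth_onM => //; exact: smooth_on_cst.
by apply/funext => x; rewrite mulN1r.
Qed.

Lemma smooth_onB (U : set V) (f g : V -> R) : open U ->
  smooth_on U (f : _ -> R^o) -> smooth_on U (g : _ -> R^o) ->
  smooth_on U (fun x => f x - g x : R^o).
Proof. by move=> Uo sf sg; apply: smooth_onD => //; exact: smooth_onN. Qed.

Lemma smooth_on_inv (U : set V) (f : V -> R) : open U ->
  (forall x, U x -> f x != 0) ->
  smooth_on U (f : _ -> R^o) -> smooth_on U (fun x => (f x)^-1 : R^o).
Proof.
by move=> Uo f0 sf; apply/smooth_algP => //; apply: SmoothInv => //; exact: SmoothBase.
Qed.

Lemma smooth_on_sum (U : set V) I (s : seq I) (f : I -> V -> R) : open U ->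
  (forall i, smooth_on U (f i : _ -> R^o)) ->
  smooth_on U (fun x => \sum_(i <- s) f i x : R^o).
Proof.
move=> Uo sf; apply/smooth_algP => //; apply: smooth_alg_sum => // i.
exact: SmoothBase.
Qed.

Lemma smooth_on_prod (U : set V) I (s : seq I) (f : I -> V -> R) : open U ->
  (forall i, smooth_on U (f i : _ -> R^o)) ->
  smooth_on U (fun x => \prod_(i <- s) f i x : R^o).
Proof.
move=> Uo sf; apply/smooth_algP => //; apply: smooth_alg_prod => // i.
exact: SmoothBase.
Qed.

Lemma smooth_on_comp n (U : set V) (U' : set 'rV[R]_n) (F : V -> 'rV[R]_n)
    (u : 'rV[R]_n -> R) : open U ->
  (forall x, U x -> U' (F x)) -> smooth_on U F -> smooth_on U' (u : _ -> R^o) ->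
  smooth_on U (fun x => u (F x) : R^o).
Proof.
by move=> Uo UU' sF su; apply/smooth_algP => //; exact: (@SmoothComp _ _ U').
Qed.

Lemma smooth_on_det n (U : set V) (A : V -> 'M[R]_n) : open U ->
  (forall i j, smooth_on U (fun x => A x i j : R^o)) ->
  smooth_on U (fun x => \det (A x) : R^o).
Proof.
move=> Uo sA; rewrite /determinant; apply: smooth_on_sum => // s.
apply: smooth_onM => //; first exact: smooth_on_cst.
exact: smooth_on_prod.
Qed.

(** Cramer's rule: each entry of the inverse is a cofactor divided by the determinant, hence a
    quotient of polynomials in the entries of [A x]. *)
Lemma smooth_on_invmx n (U : set V) (A : V -> 'M[R]_n) : open U ->
  (forall x, U x -> A x \in unitmx) ->
  (forall i j, smooth_on U (fun x => A x i j : R^o)) ->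
  forall i j, smooth_on U (fun x => invmx (A x) i j : R^o).
Proof.
move=> Uo uA sA i j.
apply: (@eq_smooth_on _ _ _ _
  (fun x => (\det (A x))^-1 * ((-1) ^+ (j + i) * \det (row' j (col' i (A x)))) : R^o)) => //.
  move=> x /set_mem Ux; rewrite /invmx uA// !mxE /cofactor.
  by [].
apply: smooth_onM => //.
  apply: smooth_on_inv => //; last exact: smooth_on_det.
  by move=> x /uA; rewrite unitmxE unitfE.
apply: smooth_onM => //; first exact: smooth_on_cst.
apply: smooth_on_det => // k l.
rewrite (_ : (fun _ => _) = fun x => A x (lift j k) (lift i l) : R^o) //.
by apply/funext => x; rewrite !mxE.
Qed.

Lemma is_derive_line (u : V -> R) (x v : V) (t : R) :
  differentiable (u : _ -> R^o) (x + t *: v) ->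
  is_derive t 1 (fun s : R => u (x + s *: v) : R^o) ('D_v (u : _ -> R^o) (x + t *: v)).
Proof.
move=> du.
have dl : is_diff t (fun s : R => x + s *: v) (fun s : R => s *: v).
  by apply: (@is_diff_eq _ _ _ _ (0 + ( *:%R^~ v))); rewrite add0r.
have dcomp : differentiable (fun s : R => u (x + s *: v) : R^o) t.
  apply: (@differentiable_comp _ _ _ _ (fun s : R => x + s *: v) (u : _ -> R^o)) => //.
apply: DeriveDef; first exact: diff_derivable.
rewrite deriveE// (@diff_comp _ _ _ _ (fun s : R => x + s *: v) (u : _ -> R^o))//=.
by rewrite diff_val scale1r deriveE.
Qed.

End SmoothAlgebra.

(** * Symmetry of mixed second derivatives *)

Section Schwarz.
Variables (R : realType) (V : normedModType R).

Lemma line_MVT (u : V -> R) (x v : V) (h : R) : 0 <= h ->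
  (forall s, 0 <= s <= h -> differentiable (u : _ -> R^o) (x + s *: v)) ->
  exists2 s, 0 <= s <= h &
    u (x + h *: v) - u x = h * 'D_v (u : _ -> R^o) (x + s *: v).
Proof.
move=> h0 du.
have dl s : s \in `[0, h] -> is_derive s 1 (fun s : R => u (x + s *: v) : R^o)
    ('D_v (u : _ -> R^o) (x + s *: v)).
  by rewrite in_itv /= => sh; apply: is_derive_line; exact: du.
pose k (s : R) : R := u (x + s *: v).
pose dk (s : R) : R := 'D_v (u : _ -> R^o) (x + s *: v).
have kc : {within `[0, h], continuous k}.
  by apply: derivable_within_continuous => s /dl ds; exact: ex_derive.
have [s] : exists2 c, c \in `[0, h]%R & k h - k 0 = dk c * (h - 0).
  have dk' s : s \in `]0, h[%R -> is_derive s 1 k (dk s).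
    by rewrite in_itv /= => /andP[s0 sh]; apply: dl; rewrite in_itv /= !ltW.
  by have T := @MVT_segment R k dk 0 h h0; exact: (T dk' kc).
rewrite /k /dk in_itv /= => sh; rewrite scale0r addr0 subr0 => E.
by exists s => //; rewrite E mulrC.
Qed.

(** Two mean value theorems: along [v] for the increment [u (y + h *: w) - u y], then along [w] for
    the derivative ['D_v u]. *)
Lemma second_difference (U : set V) (u : V -> R) (x v w : V) (h : R) :
  open U -> smooth_on U (u : _ -> R^o) -> 0 <= h ->
  (forall s t, 0 <= s <= h -> 0 <= t <= h -> U (x + s *: v + t *: w)) ->
  exists s t, [/\ 0 <= s <= h, 0 <= t <= h &
    u (x + h *: v + h *: w) - u (x + h *: v) - u (x + h *: w) + u x =
    h * h * 'D_w ('D_v (u : _ -> R^o)) (x + s *: v + t *: w)].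
Proof.
move=> Uo su h0 Uh.
have hh : 0 <= h <= h by rewrite h0 lexx.
have h00 : 0 <= (0 : R) <= h by rewrite lexx.
pose d y := u (y + h *: w) - u y.
have dshift y : U (y + h *: w) -> differentiable (fun z => u (z + h *: w) : R^o) y.
  move=> Uy; apply: (@differentiable_comp _ _ _ _ (fun z => z + h *: w) (u : _ -> R^o)).
    by [].
  exact: smooth_on_differentiable su Uy.
have Uv s : 0 <= s <= h -> U (x + s *: v).
  by move=> /Uh /(_ h00); rewrite scale0r addr0.
have [s sh|s sh Es] := @line_MVT d x v h h0.
  apply: differentiableB; first by apply: dshift; exact: Uh.
  by apply: smooth_on_differentiable su _; exact: Uv.
have shiftE : 'D_v (d : _ -> R^o) (x + s *: v) =
    'D_v (u : _ -> R^o) (x + s *: v + h *: w) - 'D_v (u : _ -> R^o) (x + s *: v).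
  rewrite /d derive_sub; [|by apply: dshift; exact: Uh
                          |by apply: smooth_on_differentiable su _; exact: Uv].
  congr (_ - _); rewrite deriveE; last by apply: dshift; exact: Uh.
  have dsh : is_diff (x + s *: v) (fun z => z + h *: w) id.
    by apply: is_diff_eq; rewrite addr0.
  rewrite (@diff_comp _ _ _ _ (fun z => z + h *: w) (u : _ -> R^o))//=.
    by rewrite diff_val deriveE//; apply: smooth_on_differentiable su _; exact: Uh.
  by apply: smooth_on_differentiable su _; exact: Uh.
have [t th|t th Et] := @line_MVT ('D_v (u : _ -> R^o)) (x + s *: v) w h h0.
  apply: (@smooth_on_differentiable _ _ _ U); first exact: smooth_on_derive.
  exact: Uh.
exists s, t; split => //.
by rewrite -mulrA -Et -shiftE -Es /d; ring.
Qed.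

(** The second difference over a parallelogram is unchanged when [v] and [w] are exchanged, so both
    mixed derivatives take a common value at points near [x]; continuity brings these values back to
    [x]. *)
Lemma derive_comm (U : set V) (u : V -> R) (x v w : V) :
  open U -> smooth_on U (u : _ -> R^o) -> U x ->
  'D_w ('D_v (u : _ -> R^o)) x = 'D_v ('D_w (u : _ -> R^o)) x.
Proof.
move=> Uo su Ux; apply/eqP; rewrite -subr_eq0 -normr_eq0.
rewrite eq_le normr_ge0 andbT; apply/ler_addgt0Pr => e e0; rewrite add0r.
have cont a b : {for x, continuous ('D_a ('D_b (u : _ -> R^o)))}.
  apply: differentiable_continuous; apply: (@smooth_on_differentiable _ _ _ U) => //.
  by do 2 apply: smooth_on_derive.
have e20 : 0 < e / 2 by rewrite divr_gt0.
have near_x (a b : V) : \forall y \near x,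
    `|'D_a ('D_b (u : _ -> R^o)) x - 'D_a ('D_b (u : _ -> R^o)) y| < e / 2.
  by have /cvgrPdist_lt/(_ _ e20) := cont a b.
have Unear := open_nbhs_nbhs (conj Uo Ux).
have /nbhs_ballP[d /= d0 Bd] : \forall y \near x, [/\ U y,
    `|'D_w ('D_v (u : _ -> R^o)) x - 'D_w ('D_v (u : _ -> R^o)) y| < e / 2 &
    `|'D_v ('D_w (u : _ -> R^o)) x - 'D_v ('D_w (u : _ -> R^o)) y| < e / 2].
  exact: (filterS3 _ (fun y a b c => And3 a b c) Unear (near_x w v) (near_x v w)).
(* The summand 1 keeps [N] positive even if [v] and [w] vanish. With [h = d / 2 / N] the whole
   parallelogram stays in the ball of radius [d]. *)
pose N := `|v| + `|w| + 1.
have N0 : 0 < N by rewrite ltr_wpDl ?addr_ge0.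
pose h := d / 2 / N.
have h0 : 0 < h by rewrite !divr_gt0.
have inB s t : 0 <= s <= h -> 0 <= t <= h -> ball x d (x + s *: v + t *: w).
  move=> /andP[s0 sh] /andP[t0 th].
  rewrite -ball_normE /= -addrA opprD addrA subrr sub0r normrN.
  apply: le_lt_trans (ler_normD _ _) _; rewrite !normrZ !ger0_norm//.
  apply: (@le_lt_trans _ _ (h * `|v| + h * `|w|)); first by rewrite lerD// ler_wpM2r.
  apply: (@lt_le_trans _ _ (h * N)).
    by rewrite -mulrDr ltr_pM2l// /N ltrDl.
  by rewrite /h divfK ?gt_eqF//; lra.
have inU s t : 0 <= s <= h -> 0 <= t <= h -> U (x + s *: v + t *: w).
  by move=> sh th; have [] := Bd _ (inB _ _ sh th).
have [s [t [sh th E1]]] := second_difference Uo su (ltW h0) inU.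
have inU' s' t' : 0 <= s' <= h -> 0 <= t' <= h -> U (x + s' *: w + t' *: v).
  by move=> sh' th'; rewrite addrAC; exact: inU.
have [s' [t' [sh' th' E2]]] := second_difference Uo su (ltW h0) inU'.
have [_ B1 _] := Bd _ (inB _ _ sh th).
have [_ _ B2] := Bd _ (inB _ _ th' sh').
have E : 'D_w ('D_v (u : _ -> R^o)) (x + s *: v + t *: w) =
    'D_v ('D_w (u : _ -> R^o)) (x + t' *: v + s' *: w).
  have hh : h * h != 0 by rewrite mulf_neq0// gt_eqF.
  rewrite [x + t' *: v + s' *: w]addrAC.
  have S : u (x + h *: v + h *: w) - u (x + h *: v) - u (x + h *: w) + u x =
      u (x + h *: w + h *: v) - u (x + h *: w) - u (x + h *: v) + u x.
    by rewrite [x + h *: w + h *: v]addrAC [X in X + u x]addrAC.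
  exact: (mulfI hh (etrans (esym E1) (etrans S E2))).
rewrite E in B1.
have tri (a b c : R) : `|a - c| < e / 2 -> `|b - c| < e / 2 -> `|a - b| <= e.
  move=> ac bc; apply: (le_trans (ler_distD c _ _)).
  rewrite distrC in bc; rewrite [leRHS]splitr.
  exact: (lerD (ltW ac) (ltW bc)).
exact: tri B1 B2.
Qed.

End Schwarz.

(** * Matrix-valued functions and curvature *)

(* Locked so that [mxE] and unification do not unfold into derivatives. *)
HB.lock Definition pd_mx (R : realType) n p q (a : 'I_n)
    (A : 'rV[R]_n -> 'M[R]_(p, q)) (x : 'rV[R]_n) : 'M[R]_(p, q) :=
  \matrix_(i, j) pd a (fun y => A y i j) x.

HB.lock Definition jac (R : realType) n (F : 'rV[R]_n -> 'rV[R]_n)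
    (x : 'rV[R]_n) : 'M[R]_n :=
  \matrix_(a, c) pd a (fun y => F y 0 c) x.

Section MatrixDerivative.
Variables (R : realType) (n : nat).
Local Notation V := 'rV[R]_n.

Definition smooth_mx p q (U : set V) (A : V -> 'M[R]_(p, q)) : Prop :=
  forall i j, smooth_on U (fun y => A y i j : R^o).

Lemma pd_mxE p q a (A : V -> 'M[R]_(p, q)) x i j :
  pd_mx a A x i j = pd a (fun y => A y i j) x.
Proof. by rewrite pd_mx.unlock mxE. Qed.

Lemma eq_pd (U : set V) (f h : V -> R) a x : open U -> U x ->
  {in U, f =1 h} -> pd a f x = pd a h x.
Proof.
move=> Uo Ux fh; apply: near_eq_derive.
by apply: filterS (open_nbhs_nbhs (conj Uo Ux)) => y Uy; exact/fh/mem_set.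
Qed.

Lemma eq_pd_mx p q (U : set V) (A B : V -> 'M[R]_(p, q)) a x : open U -> U x ->
  {in U, A =1 B} -> pd_mx a A x = pd_mx a B x.
Proof.
move=> Uo Ux AB; apply/matrixP => i j; rewrite !pd_mxE.
apply: (eq_pd _ Uo Ux) => y Uy; by rewrite AB.
Qed.

Lemma smooth_mx_entry p q (U : set V) (A : V -> 'M[R]_(p, q)) i j x :
  smooth_mx U A -> U x -> differentiable (fun y => A y i j : R^o) x.
Proof. by move=> sA Ux; exact: smooth_on_differentiable (sA i j) Ux. Qed.

Lemma smooth_pd_mx p q (U : set V) (A : V -> 'M[R]_(p, q)) a : open U ->
  smooth_mx U A -> smooth_mx U (pd_mx a A).
Proof.
move=> Uo sA i j; apply: eq_smooth_on (smooth_on_derive (delta_mx 0 a) (sA i j)) => //.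
by move=> y _; rewrite pd_mxE.
Qed.

Lemma smooth_mulmx p q r (U : set V) (A : V -> 'M[R]_(p, q)) (B : V -> 'M[R]_(q, r)) :
  open U -> smooth_mx U A -> smooth_mx U B -> smooth_mx U (fun y => A y *m B y).
Proof.
move=> Uo sA sB i j.
rewrite (_ : (fun _ => _) = fun y => \sum_k A y i k * B y k j : R^o).
  by apply: smooth_on_sum => // k; exact: smooth_onM.
by apply/funext => y; rewrite mxE.
Qed.

Lemma pd_mulmx p q r (U : set V) (A : V -> 'M[R]_(p, q)) (B : V -> 'M[R]_(q, r))
    a x : U x -> smooth_mx U A -> smooth_mx U B ->
  pd_mx a (fun y => A y *m B y) x = pd_mx a A x *m B x + A x *m pd_mx a B x.
Proof.
move=> Ux sA sB; apply/matrixP => i j; rewrite pd_mxE.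
transitivity (\sum_k (pd_mx a A x i k * B x k j + A x i k * pd_mx a B x k j)); last first.
  by rewrite big_split mxE; congr (_ + _); rewrite mxE.
rewrite (_ : (fun _ => _) = fun y => \sum_k A y i k * B y k j); last first.
  by apply/funext => y; rewrite mxE.
have dA k : differentiable (fun y => A y i k : R^o) x by exact: smooth_mx_entry sA Ux.
have dB k : differentiable (fun y => B y k j : R^o) x by exact: smooth_mx_entry sB Ux.
rewrite /pd derive_bigsum => [|k]; last exact: differentiableM.
by apply: eq_bigr => k _; rewrite !pd_mxE derive_mul.
Qed.

Lemma pd_mxD p q (U : set V) (A B : V -> 'M[R]_(p, q)) a x :
  U x -> smooth_mx U A -> smooth_mx U B ->
  pd_mx a (fun y => A y + B y) x = pd_mx a A x + pd_mx a B x.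
Proof.
move=> Ux sA sB; apply/matrixP => i j; rewrite mxE !pd_mxE.
rewrite (_ : (fun _ => _) = fun y => A y i j + B y i j); last first.
  by apply/funext => y; rewrite mxE.
by rewrite /pd derive_add//; [exact: smooth_mx_entry sA Ux|exact: smooth_mx_entry sB Ux].
Qed.

Lemma pd_trmx p q (A : V -> 'M[R]_(p, q)) a x :
  pd_mx a (fun y => (A y)^T) x = (pd_mx a A x)^T.
Proof.
apply/matrixP => i j; rewrite [RHS]mxE !pd_mxE; congr (pd _ _ _); apply/funext => y.
by rewrite mxE.
Qed.

Lemma smooth_trmx p q (U : set V) (A : V -> 'M[R]_(p, q)) :
  smooth_mx U A -> smooth_mx U (fun y => (A y)^T).
Proof.
move=> sA i j; rewrite (_ : (fun _ => _) = fun y => A y j i : R^o)//.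
by apply/funext => y; rewrite mxE.
Qed.

Lemma jacE (F : V -> V) x a c : jac F x a c = pd a (fun y => F y 0 c) x.
Proof. by rewrite jac.unlock mxE. Qed.

Lemma jacobianE (F : V -> V) x : differentiable F x -> jacobian F x = jac F x.
Proof.
move=> dF; apply/matrixP => a c; rewrite jacE /pd derive_coord//.
by rewrite deriveE// mxE.
Qed.

Lemma smooth_jac (U : set V) (F : V -> V) : open U -> smooth_on U F ->
  smooth_mx U (jac F).
Proof.
move=> Uo sF a c.
apply: eq_smooth_on (smooth_on_derive (delta_mx 0 a) (smooth_on_coord c Uo sF)) => //.
by move=> y _; rewrite jacE.
Qed.

(** Symmetry of the second derivatives of a coordinate change. It produces the cancellations both in
    the Christoffel law and in the curvature of the pulled-back connection. *)
Lemma pd_jacC (U : set V) (F : V -> V) a b c x : open U -> smooth_on U F -> U x ->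
  pd_mx a (jac F) x b c = pd_mx b (jac F) x a c.
Proof.
move=> Uo sF Ux; rewrite !pd_mxE.
have E d : (fun y => jac F y d c) = pd d (fun y => F y 0 c).
  by apply/funext => y; rewrite jacE.
rewrite !E; apply: (derive_comm _ _ Uo _ Ux); exact: smooth_on_coord.
Qed.

Lemma pd_comp (U U' : set V) (F : V -> V) (u : V -> R) a x :
  smooth_on U F -> smooth_on U' (u : _ -> R^o) -> U x -> U' (F x) ->
  pd a (fun y => u (F y)) x = \sum_k jac F x a k * pd k u (F x).
Proof.
move=> sF su Ux U'x; rewrite /pd derive_chain.
- by apply: eq_bigr => k _; rewrite jacE.
- exact: smooth_on_differentiable sF Ux.
- exact: smooth_on_differentiable su U'x.
Qed.

Lemma pd_mx_comp p q (U U' : set V) (F : V -> V) (A : V -> 'M[R]_(p, q)) a x :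
  smooth_on U F -> smooth_mx U' A -> U x -> U' (F x) ->
  pd_mx a (fun y => A (F y)) x = \sum_k jac F x a k *: pd_mx k A (F x).
Proof.
move=> sF sA Ux U'x; apply/matrixP => i j; rewrite summxE pd_mxE.
rewrite (pd_comp a sF (sA i j) Ux U'x).
by apply: eq_bigr => k _; rewrite mxE pd_mxE.
Qed.

Lemma smooth_mx_comp p q (U U' : set V) (F : V -> V) (A : V -> 'M[R]_(p, q)) :
  open U -> (forall x, U x -> U' (F x)) ->
  smooth_on U F -> smooth_mx U' A -> smooth_mx U (fun y => A (F y)).
Proof.
move=> Uo FU sF sA i j.
exact: (@smooth_on_comp _ _ _ U U' F (fun y => A y i j)).
Qed.

End MatrixDerivative.

(** * Connection and curvature as matrix-valued functions *)

Section Geometry.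
Variables (R : realType) (n : nat).
Local Notation V := 'rV[R]_n.

(* Entry (s, r) of [conn_mx g a] is Gamma^r_{as}: with this transposed
   layout the connection transforms by J on the left, like row vectors. *)
Definition conn_mx (g : V -> 'M[R]_n) (a : 'I_n) (x : V) : 'M[R]_n :=
  \matrix_(s, r) christoffel g r a s x.

Definition riemann_mx (g : V -> 'M[R]_n) (a b : 'I_n) (x : V) : 'M[R]_n :=
  \matrix_(s, r) riemann g r s a b x.

Lemma smooth_conn_mx (U : set V) (g : V -> 'M[R]_n) a : open U ->
  smooth_mx U g -> (forall x, U x -> g x \in unitmx) -> smooth_mx U (conn_mx g a).
Proof.
move=> Uo sg ug s r.
rewrite (_ : (fun _ => _) = fun y => christoffel g r a s y : R^o); last first.
  by apply/funext => y; rewrite mxE.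
rewrite /christoffel; apply: smooth_onM => //; first exact: smooth_on_cst.
apply: smooth_on_sum => // l; apply: smooth_onM => //.
  exact: smooth_on_invmx.
by apply: smooth_onB => //; [apply: smooth_onD => //|]; apply: smooth_on_derive.
Qed.

(** The curvature is the field strength of the connection one-form. The commutator appears in
    reversed order because of the transposed layout of [conn_mx]. *)
Lemma riemann_mxE (g : V -> 'M[R]_n) a b x :
  riemann_mx g a b x = pd_mx a (conn_mx g b) x - pd_mx b (conn_mx g a) x
    + (conn_mx g b x *m conn_mx g a x - conn_mx g a x *m conn_mx g b x).
Proof.
apply/matrixP => s r; rewrite [LHS]mxE /riemann sumrB [RHS]mxE; congr (_ + _).
  rewrite [RHS]mxE [X in _ = _ + X]mxE !pd_mxE.
  have E c : christoffel g r c s = fun y => conn_mx g c y s r.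
    by apply/funext => y; rewrite mxE.
  by rewrite (E a) (E b).
rewrite [RHS]mxE [X in _ = _ + X]mxE; congr (_ - _); rewrite mxE;
  by apply: eq_bigr => l _; rewrite !mxE mulrC.
Qed.

Lemma smooth_riemann_mx (U : set V) (g : V -> 'M[R]_n) a b : open U ->
  smooth_mx U g -> (forall x, U x -> g x \in unitmx) -> smooth_mx U (riemann_mx g a b).
Proof.
move=> Uo sg ug s r.
have sc c : smooth_mx U (conn_mx g c) by exact: smooth_conn_mx.
pose h y := pd_mx a (conn_mx g b) y s r - pd_mx b (conn_mx g a) y s r
    + ((conn_mx g b y *m conn_mx g a y) s r - (conn_mx g a y *m conn_mx g b y) s r).
rewrite (_ : (fun _ => _) = (h : _ -> R^o)); last first.
  by apply/funext => y; rewrite riemann_mxE /h !mxE.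
apply: smooth_onD => //; apply: smooth_onB => //.
- exact: smooth_pd_mx.
- exact: smooth_pd_mx.
- exact: smooth_mulmx.
- exact: smooth_mulmx.
Qed.

Lemma smooth_ricci (U : set V) (g : V -> 'M[R]_n) : open U ->
  smooth_mx U g -> (forall x, U x -> g x \in unitmx) -> smooth_mx U (ricci g).
Proof.
move=> Uo sg ug a b.
rewrite (_ : (fun _ => _) = fun y => - \sum_r riemann_mx g r b y a r : R^o); last first.
  by apply/funext => y; rewrite mxE; congr (- _); apply: eq_bigr => r _; rewrite mxE.
by apply: smooth_onN => //; apply: smooth_on_sum => // r; exact: smooth_riemann_mx.
Qed.

Lemma mtraceE (g : V -> 'M[R]_n) S x : mtrace g S x = \tr (invmx (g x) *m S^T).
Proof.
apply: eq_bigr => a _; rewrite mxE; apply: eq_bigr => b _.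
by rewrite [in RHS]mxE.
Qed.

End Geometry.

(** * Change of coordinates *)

Section ChristoffelAlgebra.
Variables (R : realType) (n : nat).

(** Twice the Christoffel symbol of the first kind when [D a] is the a-th partial derivative of the
    metric. Leaving [D] abstract makes the transformation law pure matrix algebra. *)
Definition first_kind (D : 'I_n -> 'M[R]_n) (a b : 'I_n) : 'cV[R]_n :=
  \col_l (D a b l + D b a l - D l a b).

Variables (J G g : 'M[R]_n) (H DG : 'I_n -> 'M[R]_n).
Hypothesis gE : g = J *m G *m J^T.
Hypothesis g_unit : g \in unitmx.
Hypothesis G_sym : G^T = G.
Hypothesis H_sym : forall a b c, H a b c = H b a c.

(** The Leibniz rule for the a-th derivative of [J *m G *m J^T]: [H a] stands for the derivative of
    [J], and the chain rule turns the derivatives [DG r] of [G] into the middle sum. *)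
Definition congruence_variation (a : 'I_n) : 'M[R]_n :=
  H a *m G *m J^T + J *m (\sum_r J a r *: DG r) *m J^T + J *m G *m (H a)^T.

Lemma congruence_unit : (J \in unitmx) * (G \in unitmx).
Proof.
by move: g_unit; rewrite gE !unitmx_mul => /andP[/andP[-> ->]].
Qed.

Lemma congruence_invmx : J^T *m invmx g *m J = invmx G.
Proof.
have [Ju Gu] := congruence_unit.
have JTu : J^T \in unitmx by rewrite unitmx_tr.
have AG : J^T *m invmx g *m J *m G = 1%:M.
  rewrite -[LHS]mulmx1 -(mulmxV JTu) [LHS]mulmxA.
  have -> : J^T *m invmx g *m J *m G *m J^T = J^T *m invmx g *m g.
    by rewrite gE !mulmxA.
  by rewrite mulmxKV// mulmxV.
by rewrite -[LHS]mulmx1 -(mulmxV Gu) mulmxA AG mul1mx.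
Qed.

Lemma hessian_termE a b l :
  (H a *m G *m J^T) b l = (J *m (row b (H a *m G))^T) l 0.
Proof. by rewrite !mxE; apply: eq_bigr => q _; rewrite !mxE mulrC. Qed.

Lemma hessian_termC a b l : (H a *m G *m J^T) b l = (H b *m G *m J^T) a l.
Proof.
rewrite !mxE; apply: eq_bigr => q _; rewrite !mxE; congr (_ * _).
by apply: eq_bigr => p _; rewrite H_sym.
Qed.

Lemma metric_termE a b l : (J *m (\sum_r J a r *: DG r) *m J^T) b l =
  \sum_r \sum_c \sum_e J l c * (J a r * (J b e * DG r e c)).
Proof.
rewrite mulmx_sumr mulmx_suml summxE; apply: eq_bigr => r _.
rewrite -scalemxAr -scalemxAl mxE mxE mulr_sumr; apply: eq_bigr => c _.
rewrite !mxE mulr_suml mulr_sumr; apply: eq_bigr => e _.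
by ring.
Qed.

(** The three metric derivatives contribute six terms containing [H]. By the symmetry of [H] four of
    them cancel and the other two coincide, whence the factor 2. *)
Lemma first_kind_congruence a b :
  first_kind congruence_variation a b =
  J *m (2 *: (row b (H a *m G))^T +
        \sum_d \sum_e (J a d * J b e) *: first_kind DG d e).
Proof.
apply/colP => l; rewrite mulmxDr -scalemxAr [RHS]mxE [X in _ = X + _]mxE.
rewrite -hessian_termE.
have GH c : J *m G *m (H c)^T = (H c *m G *m J^T)^T.
  by rewrite !trmx_mul trmxK G_sym mulmxA.
have Q1 := metric_termE a b l; have Q2 := metric_termE b a l.
have Q3 := metric_termE l a b.
have entryE c i j : congruence_variation c i j = (H c *m G *m J^T) i j +
    (J *m (\sum_r J c r *: DG r) *m J^T) i j + (H c *m G *m J^T) j i.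
  by rewrite /congruence_variation GH [LHS]mxE [X in X + _ = _]mxE [X in _ + X = _]mxE.
rewrite /first_kind mxE !entryE Q1 Q2 Q3.
rewrite (hessian_termC b a l) (hessian_termC l a b) (hessian_termC b l a).
have -> : (J *m (\sum_d \sum_e (J a d * J b e) *:
      \col_l (DG d e l + DG e d l - DG l d e))) l 0 =
    \sum_c \sum_d \sum_e J l c * (J a d * (J b e * DG d e c))
    + \sum_c \sum_d \sum_e J l c * (J a d * (J b e * DG e d c))
    - \sum_c \sum_d \sum_e J l c * (J a d * (J b e * DG c d e)).
  rewrite mxE -big_split -sumrB; apply: eq_bigr => c _.
  rewrite summxE mulr_sumr -big_split -sumrB; apply: eq_bigr => d _.
  rewrite summxE mulr_sumr -big_split -sumrB; apply: eq_bigr => e _.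
  by rewrite !mxE /=; ring.
have -> : \sum_r \sum_c \sum_e J l c * (J a r * (J b e * DG r e c)) =
    \sum_c \sum_d \sum_e J l c * (J a d * (J b e * DG d e c)).
  by rewrite exchange_big.
have -> : \sum_r \sum_c \sum_e J l c * (J b r * (J a e * DG r e c)) =
    \sum_c \sum_d \sum_e J l c * (J a d * (J b e * DG e d c)).
  rewrite exchange_big; apply: eq_bigr => c _; rewrite exchange_big.
  by apply: eq_bigr => d _; apply: eq_bigr => e _; ring.
have -> : \sum_r \sum_c \sum_e J b c * (J l r * (J a e * DG r e c)) =
    \sum_c \sum_d \sum_e J l c * (J a d * (J b e * DG c d e)).
  apply: eq_bigr => c _; rewrite exchange_big.
  by apply: eq_bigr => d _; apply: eq_bigr => e _; ring.
by ring.
Qed.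

(** The classical law for Christoffel symbols, doubled. Multiplying by [J^T] on the left turns
    [invmx g] into [invmx G] by [congruence_invmx], so no inverse of [J] is left. *)
Lemma second_kind_congruence a b :
  J^T *m (invmx g *m first_kind congruence_variation a b) =
  2 *: (row b (H a))^T
  + \sum_d \sum_e (J a d * J b e) *: (invmx G *m first_kind DG d e).
Proof.
have [_ Gu] := congruence_unit.
rewrite first_kind_congruence !mulmxA congruence_invmx mulmxDr -scalemxAr.
rewrite row_mul trmx_mul G_sym mulmxA mulVmx// mul1mx mulmx_sumr; congr (_ + _).
apply: eq_bigr => d _; rewrite mulmx_sumr.
by apply: eq_bigr => e _; rewrite -scalemxAr.
Qed.

End ChristoffelAlgebra.

(** * Transformation laws under a smooth change of coordinates *)

Section CoordinateChange.
Variables (R : realType) (n : nat).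
Local Notation V := 'rV[R]_n.
Variables (U U' : set V) (F : V -> V) (g G : V -> 'M[R]_n).
Hypothesis U_open : open U.
Hypothesis U'_open : open U'.
Hypothesis F_smooth : smooth_on U F.
Hypothesis F_maps : forall x, U x -> U' (F x).
Hypothesis g_smooth : smooth_mx U g.
Hypothesis G_smooth : smooth_mx U' G.
Hypothesis g_unit : forall x, U x -> g x \in unitmx.
Hypothesis G_unit : forall x, U' x -> G x \in unitmx.
Hypothesis G_sym : forall x, U' x -> (G x)^T = G x.
Hypothesis g_pullback : forall x, U x -> g x = jac F x *m G (F x) *m (jac F x)^T.

Let J := jac F.

Let J_smooth : smooth_mx U J.
Proof. exact: smooth_jac. Qed.

(** Invertibility is read off the nondegenerate metric [g = J G J^T], without an inverse coordinate
    change. *)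
Lemma jac_unit x : U x -> J x \in unitmx.
Proof. by move=> Ux; have [] := congruence_unit (g_pullback Ux) (g_unit Ux). Qed.

Lemma conn_mxE (h : V -> 'M[R]_n) a x s r : conn_mx h a x s r =
  (2^-1 *: (invmx (h x) *m first_kind (fun c => pd_mx c h x) a s)) r 0.
Proof.
rewrite mxE /christoffel mxE mxE; congr (_ * _).
by apply: eq_bigr => l _; rewrite mxE !pd_mxE.
Qed.

Lemma pd_metric a x : U x -> pd_mx a g x =
  congruence_variation (J x) (G (F x)) (fun c => pd_mx c J x)
    (fun c => pd_mx c G (F x)) a.
Proof.
move=> Ux; rewrite /congruence_variation -(pd_mx_comp a F_smooth G_smooth Ux (F_maps Ux)).
have sGF : smooth_mx U (fun y => G (F y)).
  exact: smooth_mx_comp U_open F_maps F_smooth G_smooth.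
have sJG : smooth_mx U (fun y => J y *m G (F y)) by exact: smooth_mulmx.
have sJT : smooth_mx U (fun y => (J y)^T) by exact: smooth_trmx.
rewrite (@eq_pd_mx _ _ _ _ U _ (fun y => J y *m G (F y) *m (J y)^T) a x U_open Ux).
  rewrite (pd_mulmx a Ux sJG sJT) (pd_mulmx a Ux J_smooth sGF) pd_trmx.
  by rewrite mulmxDl.
by move=> y /set_mem Uy; exact: g_pullback.
Qed.

(** Only the one-form index of the target connection is pulled back; the matrix indices stay in the
    target frame. The remaining discrepancy with [conn_mx g] is a gauge transformation by [J]. *)
Definition conn_pullback a x : 'M[R]_n := \sum_d J x a d *: conn_mx G d (F x).

(** Gauge law with inhomogeneous term the derivative of [J]. Written with [J] as a factor on both
    sides, it can be differentiated by the product rule alone. *)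
Lemma conn_transform a x : U x ->
  conn_mx g a x *m J x = pd_mx a J x + J x *m conn_pullback a x.
Proof.
move=> Ux; apply/matrixP => b c.
have H_sym a' b' c' : pd_mx a' J x b' c' = pd_mx b' J x a' c'.
  exact: pd_jacC U_open F_smooth Ux.
have K := second_kind_congruence (fun c => pd_mx c G (F x)) (g_pullback Ux)
  (g_unit Ux) (G_sym (F_maps Ux)) H_sym a b.
have -> : (conn_mx g a x *m J x) b c = (2^-1 *: ((J x)^T *m (invmx (g x) *m
    first_kind (congruence_variation (J x) (G (F x)) (fun c => pd_mx c J x)
    (fun c => pd_mx c G (F x))) a b))) c 0.
  rewrite scalemxAr mxE [RHS]mxE; apply: eq_bigr => k _.
  rewrite conn_mxE mulrC [X in _ = X * _]mxE; congr (_ * _).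
  congr ((_ *: (_ *m _)) _ _); apply/colP => l; rewrite [LHS]mxE [RHS]mxE.
  by rewrite !(pd_metric _ Ux).
rewrite K mxE mxE mulrDr [RHS]mxE; congr (_ + _).
  by rewrite !mxE mulKf.
rewrite summxE mxE mulr_sumr.
transitivity (\sum_d \sum_e J x b e * (J x a d * conn_mx G d (F x) e c)).
  apply: eq_bigr => d _; rewrite summxE mulr_sumr; apply: eq_bigr => e _.
  by rewrite conn_mxE !mxE; ring.
rewrite exchange_big; apply: eq_bigr => e _.
rewrite /conn_pullback summxE mulr_sumr; apply: eq_bigr => d _.
by rewrite [in RHS]mxE.
Qed.

Let conn_smooth a : smooth_mx U (conn_mx g a).
Proof. exact: smooth_conn_mx. Qed.

Let conn'_smooth a : smooth_mx U' (conn_mx G a).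
Proof. exact: smooth_conn_mx. Qed.

Lemma smooth_conn_pullback a : smooth_mx U (conn_pullback a).
Proof.
move=> i j; rewrite (_ : (fun _ => _) =
    fun y => \sum_d J y a d * conn_mx G d (F y) i j : R^o); last first.
  by apply/funext => y; rewrite summxE; apply: eq_bigr => d _; rewrite mxE.
apply: smooth_on_sum => // d; apply: smooth_onM => //.
exact: (smooth_mx_comp U_open F_maps F_smooth (conn'_smooth d)).
Qed.

Lemma pd_conn_pullback a b x : U x -> pd_mx a (conn_pullback b) x =
  \sum_d (pd_mx a J x b d *: conn_mx G d (F x) +
    \sum_c (J x a c * J x b d) *: pd_mx c (conn_mx G d) (F x)).
Proof.
move=> Ux; apply/matrixP => i j; rewrite pd_mxE summxE.
rewrite (_ : (fun _ => _) =
    fun y => \sum_d J y b d * conn_mx G d (F y) i j); last first.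
  by apply/funext => y; rewrite summxE; apply: eq_bigr => d _; rewrite mxE.
have dJ d : differentiable (fun y => J y b d : R^o) x.
  exact: smooth_mx_entry J_smooth Ux.
have dG d : differentiable (fun y => conn_mx G d (F y) i j : R^o) x.
  exact: (smooth_mx_entry _ _ (smooth_mx_comp U_open F_maps F_smooth (conn'_smooth d)) Ux).
rewrite {1}/pd derive_bigsum => [|d]; last exact: differentiableM.
apply: eq_bigr => d _; rewrite derive_mul// [RHS]mxE [X in _ = X + _]mxE pd_mxE.
congr (_ + _).
rewrite -[X in J x b d * X]/(pd a (fun y => conn_mx G d (F y) i j) x).
rewrite (pd_comp a F_smooth (conn'_smooth d i j) Ux (F_maps Ux)).
rewrite summxE mulr_sumr; apply: eq_bigr => c _; rewrite [RHS]mxE pd_mxE.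
by rewrite mulrA [J x b d * _]mulrC.
Qed.

Lemma pd_conn_transform a b x : U x ->
  pd_mx a (conn_mx g b) x *m J x + conn_mx g b x *m pd_mx a J x =
  pd_mx a (pd_mx b J) x + (pd_mx a J x *m conn_pullback b x
    + J x *m pd_mx a (conn_pullback b) x).
Proof.
move=> Ux.
have sdJ : smooth_mx U (pd_mx b J) by exact: smooth_pd_mx.
have sp := smooth_conn_pullback b.
rewrite -(pd_mulmx a Ux (conn_smooth b) J_smooth) -(pd_mulmx a Ux J_smooth sp).
rewrite -(pd_mxD a Ux sdJ (smooth_mulmx U_open J_smooth sp)).
by apply: (eq_pd_mx a U_open Ux) => y /set_mem Uy; exact: conn_transform.
Qed.

Lemma pd2_jacC a b x : U x -> pd_mx a (pd_mx b J) x = pd_mx b (pd_mx a J) x.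
Proof.
move=> Ux; apply/matrixP => i j; rewrite !pd_mxE.
have E c : (fun y => pd_mx c J y i j) = pd c (fun y => J y i j).
  by apply/funext => y; rewrite pd_mxE.
rewrite !E; exact: (derive_comm _ _ U_open (J_smooth i j) Ux).
Qed.

(** Pullback commutes with curvature: derivatives of the pulled-back form also hit the coefficients
    [J x a d], but these contributions are symmetric in [a] and [b] and drop out of the
    difference. *)
Lemma curvature_pullback a b x : U x ->
  pd_mx a (conn_pullback b) x - pd_mx b (conn_pullback a) x
  + (conn_pullback b x *m conn_pullback a x - conn_pullback a x *m conn_pullback b x)
  = \sum_c \sum_d (J x a c * J x b d) *: riemann_mx G c d (F x).
Proof.
move=> Ux; rewrite !(pd_conn_pullback _ _ Ux).
have HC d : pd_mx a J x b d = pd_mx b J x a d by exact: pd_jacC U_open F_smooth Ux.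
have mulE a' b' : conn_pullback b' x *m conn_pullback a' x =
    \sum_c \sum_d (J x a' c * J x b' d) *: (conn_mx G d (F x) *m conn_mx G c (F x)).
  rewrite /conn_pullback mulmx_suml exchange_big; apply: eq_bigr => d _.
  rewrite mulmx_sumr; apply: eq_bigr => c _.
  by rewrite -scalemxAl -scalemxAr scalerA mulrC.
rewrite (mulE a b) (mulE b a) !big_split /=.
have -> : \sum_d pd_mx a J x b d *: conn_mx G d (F x) =
    \sum_d pd_mx b J x a d *: conn_mx G d (F x).
  by apply: eq_bigr => d _; rewrite HC.
have cancel (S A B M N : 'M[R]_n) : S + A - (S + B) + (M - N) = A - B + (M - N).
  by congr (_ + _); rewrite opprD addrACA subrr add0r.
rewrite cancel exchange_big /= [X in _ + (_ - X)]exchange_big /=.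
rewrite -!sumrB -big_split; apply: eq_bigr => c _.
rewrite -!sumrB -big_split; apply: eq_bigr => d _ /=.
by rewrite riemann_mxE scalerDr !scalerBr [J x b d * _]mulrC.
Qed.

(** Antisymmetrising the derivative of [conn_transform] removes the second derivatives of [J]. The
    terms with a first derivative of [J] then cancel against those coming from the commutator. *)
Lemma riemann_transform a b x : U x ->
  riemann_mx g a b x *m J x =
  J x *m \sum_c \sum_d (J x a c * J x b d) *: riemann_mx G c d (F x).
Proof.
move=> Ux; rewrite -(curvature_pullback a b Ux) riemann_mxE.
have Eab := pd_conn_transform a b Ux; have Eba := pd_conn_transform b a Ux.
rewrite (pd2_jacC b a Ux) in Eba.
have Ea := conn_transform a Ux; have Eb := conn_transform b Ux.
rewrite !mulmxDl !mulNmx -!mulmxA Ea Eb !mulmxDr !mulmxN.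
move: Eab Eba => /(canRL (addrK _)) -> /(canRL (addrK _)) ->.
rewrite !mulmxA Ea Eb !mulmxDl.
by apply/matrixP => i j; rewrite !mxE; ring.
Qed.

(** Ricci contracts a form index with a matrix index: the Jacobian carried by the first meets the
    inverse Jacobian carried by the second, and the two cancel. *)
Lemma ricci_transform x : U x ->
  ricci g x = J x *m ricci G (F x) *m (J x)^T.
Proof.
move=> Ux; have Ju := jac_unit Ux; apply/matrixP => a b.
pose Y c := \sum_d J x b d *: riemann_mx G c d (F x).
have riemE r : riemann_mx g r b x =
    \sum_c J x r c *: (J x *m Y c *m invmx (J x)).
  rewrite -[LHS]mulmx1 -(mulmxV Ju) mulmxA (riemann_transform _ _ Ux).
  rewrite mulmx_sumr mulmx_suml; apply: eq_bigr => c _.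
  rewrite scalemxAl scalemxAr /Y scaler_sumr.
  by congr (_ *m _ *m _); apply: eq_bigr => d _; rewrite scalerA.
have lhsE : ricci g x a b = - \sum_c (J x *m Y c) a c.
  rewrite mxE; congr (- _).
  transitivity (\sum_r \sum_c J x r c * (J x *m Y c *m invmx (J x)) a r).
    apply: eq_bigr => r _.
    have -> : riemann g r a r b x = riemann_mx g r b x a r by rewrite mxE.
    rewrite riemE.
    by rewrite summxE; apply: eq_bigr => c _; rewrite mxE.
  rewrite exchange_big; apply: eq_bigr => c _.
  rewrite -[in RHS](mulmx1 (J x *m Y c)) -(mulVmx Ju) mulmxA [RHS]mxE.
  by apply: eq_bigr => r _; rewrite mulrC.
rewrite lhsE [RHS]mxE -sumrN.
(* Once the contraction is done both sides are triple sums of this summand and differ only in the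
   order of summation. *)
pose t c d e := - (J x a e * (J x b d * riemann_mx G c d (F x) e c)).
transitivity (\sum_c \sum_e \sum_d t c d e).
  apply: eq_bigr => c _; rewrite [X in - X]mxE -sumrN; apply: eq_bigr => e _.
  rewrite /Y summxE mulr_sumr -sumrN; apply: eq_bigr => d _.
  by rewrite [X in _ * X]mxE.
transitivity (\sum_d \sum_e \sum_c t c d e).
  rewrite exchange_big [RHS]exchange_big; apply: eq_bigr => e _.
  exact: exchange_big.
apply: eq_bigr => d _; rewrite [X in _ = X * _]mxE mulr_suml.
apply: eq_bigr => e _; rewrite !mxE mulrN mulNr sumrN; congr (- _).
by rewrite mulr_sumr mulr_suml; apply: eq_bigr => c _; rewrite mxE; ring.
Qed.

Lemma mtrace_transform (S S' : 'M[R]_n) x : U x ->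
  S = J x *m S' *m (J x)^T -> mtrace g S x = mtrace G S' (F x).
Proof.
move=> Ux ->; rewrite !mtraceE -(congruence_invmx (g_pullback Ux) (g_unit Ux)).
rewrite !trmx_mul trmxK mxtrace_mulC -!mulmxA mxtrace_mulC -!mulmxA.
by rewrite mxtrace_mulC !mulmxA.
Qed.

Lemma scalar_curv_transform x : U x -> scalar_curv g x = scalar_curv G (F x).
Proof. by move=> Ux; exact: (mtrace_transform Ux (ricci_transform Ux)). Qed.

Lemma grad2_transform (u : V -> R) x : U x -> smooth_on U' (u : _ -> R^o) ->
  grad2 g (fun y => u (F y)) x = grad2 G u (F x).
Proof.
move=> Ux su; apply: (mtrace_transform Ux); apply/matrixP => a b.
rewrite mxE !(pd_comp _ F_smooth su Ux (F_maps Ux)) mxE mulr_sumr.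
apply: eq_bigr => d _; rewrite [X in _ = X * _]mxE [X in _ = _ * X]mxE.
rewrite mulrCA [RHS]mulrC; congr (_ * _); rewrite !mulr_suml.
by apply: eq_bigr => c _; rewrite mxE mulrA.
Qed.

End CoordinateChange.

(** * Pointwise algebra of the stress tensor *)

Section LorentzianAlgebra.
Variable R : realType.

(** The pairing has a plus sign because [b] holds the components of a covector and [a] those of a
    unit timelike vector. The difference of the two sides is a quadratic polynomial in [b0];
    multiplied by its leading coefficient [A] it is a square plus [A * B - s ^+ 2]. *)
Lemma reverse_CauchySchwarz n (a0 b0 : R) (a b : 'I_n -> R) :
  a0 ^+ 2 - \sum_i a i ^+ 2 = 1 ->
  b0 ^+ 2 - \sum_i b i ^+ 2 <= (a0 * b0 + \sum_i a i * b i) ^+ 2.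
Proof.
set A := \sum_i a i ^+ 2; set B := \sum_i b i ^+ 2; set s := \sum_i a i * b i.
move=> /eqP; rewrite subr_eq => /eqP a0E.
have A0 : 0 <= A by apply: sumr_ge0 => i _; exact: sqr_ge0.
have B0 : 0 <= B by apply: sumr_ge0 => i _; exact: sqr_ge0.
rewrite -subr_ge0.
have -> : (a0 * b0 + s) ^+ 2 - (b0 ^+ 2 - B) = A * b0 ^+ 2 + 2 * a0 * b0 * s + s ^+ 2 + B.
  by rewrite sqrrD exprMn a0E; ring.
(* Completing the square needs [A] positive. If [A] vanishes, so do all [a i], and only [B]
   remains. *)
have [A_eq0|A_neq0] := eqVneq A 0.
  have s0 : s = 0.
    apply: big1 => i _.
    have /eqP := A_eq0; rewrite psumr_eq0 => [/allP/(_ i)|j _]; last exact: sqr_ge0.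
    by rewrite mem_index_enum sqrf_eq0 => /(_ isT)/eqP ->; rewrite mul0r.
  by rewrite A_eq0 s0 mul0r mulr0 expr0n /= !add0r.
have A_gt0 : 0 < A by rewrite lt_def A_neq0.
(* The Euclidean Cauchy-Schwarz inequality, multiplied by [A] so that it becomes a sum of
   squares. *)
have CS : 0 <= A * (A * B - s ^+ 2).
  have -> : A * (A * B - s ^+ 2) = \sum_i (b i * A - a i * s) ^+ 2.
    transitivity (\sum_i (A ^+ 2 * b i ^+ 2 - 2 * A * s * (a i * b i) + s ^+ 2 * a i ^+ 2)).
      by rewrite big_split sumrB -!mulr_sumr -/A -/B -/s /=; ring.
    by apply: eq_bigr => i _; ring.
  by apply: sumr_ge0 => i _; exact: sqr_ge0.
rewrite -(pmulr_rge0 _ A_gt0).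
have -> : A * (A * b0 ^+ 2 + 2 * a0 * b0 * s + s ^+ 2 + B) =
    (A * b0 + a0 * s) ^+ 2 + (A * B - s ^+ 2).
  by rewrite sqrrD [(a0 * s) ^+ 2]exprMn a0E; ring.
by rewrite addr_ge0 ?sqr_ge0// -(pmulr_rge0 _ A_gt0).
Qed.

Lemma lorentz_formE n (a b : 'rV[R]_n.+1) : (a *m lorentz_sign R n.+1 *m b^T) 0 0 =
  a 0 0 * b 0 0 - \sum_(i < n) a 0 (lift ord0 i) * b 0 (lift ord0 i).
Proof.
rewrite mul_mx_diag mxE big_ord_recl -sumrN; congr (_ + _).
  by rewrite !mxE /= mulr1.
by apply: eq_bigr => i _; rewrite !mxE /= mulrN1 mulNr.
Qed.

Lemma lorentz_sign_sqr n : lorentz_sign R n *m lorentz_sign R n = 1%:M.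
Proof.
rewrite /lorentz_sign mulmx_diag; apply/matrixP => i j; rewrite !mxE.
by case: ifP; rewrite ?mulr1// mulrNN mulr1.
Qed.

Lemma mx_evalE n (S : 'M[R]_n) (v : 'rV[R]_n) : mx_eval S v = (v *m S *m v^T) 0 0.
Proof.
rewrite /mx_eval exchange_big mxE; apply: eq_bigr => b _.
rewrite !mxE mulr_suml; apply: eq_bigr => a _.
by rewrite [S a b * _]mulrC.
Qed.

(** The rows of [P] form an orthonormal frame. In it [v] has components [a], the covector [w] has
    components [b], and the metric and its inverse are both [lorentz_sign]. *)
Lemma lorentz_covector_le n (g P : 'M[R]_n) (v w : 'rV[R]_n) : (0 < n)%N ->
  P \in unitmx -> P *m g *m P^T = lorentz_sign R n -> mx_eval g v = 1 ->
  (w *m invmx g *m w^T) 0 0 <= ((w *m v^T) 0 0) ^+ 2.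
Proof.
case: n g P v w => // n g P v w _ Pu gP gv.
have PTu : P^T \in unitmx by rewrite unitmx_tr.
pose a := v *m invmx P; pose b := w *m P^T.
have vE : v = a *m P by rewrite /a mulmxKV.
have wE : w = b *m invmx P^T by rewrite /b mulmxK.
have eta2 := lorentz_sign_sqr n.+1.
have gE : g = invmx P *m lorentz_sign R n.+1 *m invmx P^T.
  by rewrite -gP -!mulmxA mulmxV// mulmx1 mulKmx.
have ginv : invmx g = P^T *m lorentz_sign R n.+1 *m P.
  have gu : g \in unitmx.
    rewrite gE !unitmx_mul !unitmx_inv Pu PTu andbT /=.
    by case: (mulmx1_unit eta2).
  have gi : g *m (P^T *m lorentz_sign R n.+1 *m P) = 1%:M.
    rewrite gE -!mulmxA (mulKmx PTu) (mulmxA (lorentz_sign R n.+1)) eta2 mul1mx.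
    by rewrite mulVmx.
  by rewrite -[RHS](mulKmx gu) gi mulmx1.
have av : (a *m lorentz_sign R n.+1 *m a^T) 0 0 = 1.
  by rewrite -gv mx_evalE -gP /a trmx_mul -!mulmxA (mulmxA P^T)
    trmx_inv mulmxV// mul1mx (mulmxA (invmx P)) mulVmx// mul1mx.
have bw : w *m invmx g *m w^T = b *m lorentz_sign R n.+1 *m b^T.
  by rewrite ginv /b trmx_mul trmxK !mulmxA.
have wv : w *m v^T = b *m a^T.
  by rewrite vE trmx_mul mulmxA.
rewrite bw wv lorentz_formE; move: av; rewrite lorentz_formE.
have -> : (b *m a^T) 0 0 =
    a 0 0 * b 0 0 + \sum_(i < n) a 0 (lift ord0 i) * b 0 (lift ord0 i).
  rewrite mxE big_ord_recl !mxE mulrC; congr (_ + _).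
  by apply: eq_bigr => i _; rewrite !mxE mulrC.
have sq (c : 'rV[R]_n.+1) : \sum_(i < n) c 0 (lift ord0 i) * c 0 (lift ord0 i) =
  \sum_(i < n) c 0 (lift ord0 i) ^+ 2 by apply: eq_bigr => i _; rewrite expr2.
by rewrite !sq -!expr2; exact: reverse_CauchySchwarz.
Qed.

End LorentzianAlgebra.

(** * Effective energy density in one chart *)

Section StressTensor.
Variables (R : realType) (n : nat).
Local Notation V := 'rV[R]_n.
Variable g : V -> 'M[R]_n.

Lemma mx_evalD (S T : 'M[R]_n) v : mx_eval (S + T) v = mx_eval S v + mx_eval T v.
Proof. by rewrite !mx_evalE mulmxDr mulmxDl mxE. Qed.

Lemma mx_evalZ k (S : 'M[R]_n) v : mx_eval (k *: S) v = k * mx_eval S v.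
Proof. by rewrite !mx_evalE -scalemxAr -scalemxAl mxE. Qed.

Lemma mx_evalN (S : 'M[R]_n) v : mx_eval (- S) v = - mx_eval S v.
Proof. by rewrite -scaleN1r mx_evalZ mulN1r. Qed.

Lemma mtraceD (S T : 'M[R]_n) x : mtrace g (S + T) x = mtrace g S x + mtrace g T x.
Proof. by rewrite !mtraceE raddfD mulmxDr raddfD. Qed.

Lemma mtraceZ k (S : 'M[R]_n) x : mtrace g (k *: S) x = k * mtrace g S x.
Proof. by rewrite !mtraceE linearZ /= -scalemxAr linearZ. Qed.

Lemma mtraceN (S : 'M[R]_n) x : mtrace g (- S) x = - mtrace g S x.
Proof. by rewrite -scaleN1r mtraceZ mulN1r. Qed.

Lemma mtrace_metric x : g x \in unitmx -> (g x)^T = g x -> mtrace g (g x) x = n%:R.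
Proof. by move=> gu gs; rewrite mtraceE gs mulVmx// mxtrace1. Qed.

Lemma hessian_sqr (U : set V) (u : V -> R) x : open U -> U x ->
  smooth_on U (u : _ -> R^o) ->
  hessian g (fun y => u y ^+ 2) x = (2 * u x) *: hessian g u x + 2 *: dprod u x.
Proof.
move=> Uo Ux su.
have du y : U y -> differentiable (u : _ -> R^o) y.
  exact: smooth_on_differentiable.
have pd_sqr a y : U y -> pd a (fun y => u y ^+ 2) y = 2 * (u y * pd a u y).
  move=> Uy; rewrite (_ : (fun y => u y ^+ 2) = fun y => u y * u y); last first.
    by apply/funext => z; rewrite expr2.
  rewrite /pd derive_mul; [|exact: du..].
  by rewrite mulr2n mulrDl mul1r [X in X + _]mulrC.
apply/matrixP => a b; rewrite !mxE.
have -> : pd a (pd b (fun y => u y ^+ 2)) x = pd a (fun y => 2 * (u y * pd b u y)) x.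
  by apply: (eq_pd _ Uo Ux) => y /set_mem Uy; exact: pd_sqr.
have dpd : differentiable (pd b u : _ -> R^o) x.
  exact: smooth_on_differentiable (smooth_on_derive _ su) Ux.
have -> : pd a (fun y => 2 * (u y * pd b u y)) x =
    2 * (pd a u x * pd b u x + u x * pd a (pd b u) x).
  rewrite {1}/pd derive_mul.
  - by rewrite derive_cst mul0r add0r derive_mul//; exact: du.
  - exact: differentiable_cst.
  - by apply: differentiableM => //; exact: du.
have -> : \sum_k christoffel g k a b x * pd k (fun y => u y ^+ 2) x =
    2 * u x * \sum_k christoffel g k a b x * pd k u x.
  by rewrite mulr_sumr; apply: eq_bigr => k _; rewrite pd_sqr//; ring.
by ring.
Qed.

Lemma dprod_eval (u : V -> R) x v :
  mx_eval (dprod u x) v = (\sum_k v 0 k * pd k u x) ^+ 2.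
Proof.
rewrite expr2 mulr_suml; apply: eq_bigr => a _.
by rewrite mulr_sumr; apply: eq_bigr => b _; rewrite mxE; ring.
Qed.

(** Subtracting the trace with weight [1 / (n - 2)] cancels the squared gradient of the minimally
    coupled part and the scalar curvature of the Einstein tensor. What is left of both comes from
    the term [xi * box u2], through its expansion and the field equation. *)
Lemma eff_density_formula (U : set V) (u : V -> R) (m xi : R) x v :
  (3 <= n)%N -> open U -> U x -> smooth_on U (u : _ -> R^o) ->
  g x \in unitmx -> (g x)^T = g x -> mx_eval (g x) v = 1 ->
  box g u x + (m ^+ 2 + xi * scalar_curv g x) * u x = 0 ->
  mx_eval (stress g m xi u x) v - mtrace g (stress g m xi u x) x / (n%:R - 2) =
  (\sum_k v 0 k * pd k u x) ^+ 2
  - (1 - 2 * xi) / (n%:R - 2) * m ^+ 2 * u x ^+ 2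
  + 2 * xi ^+ 2 / (n%:R - 2) * scalar_curv g x * u x ^+ 2
  - 2 * xi / (n%:R - 2) * grad2 g u x
  - 2 * xi * ((\sum_k v 0 k * pd k u x) ^+ 2 + u x * mx_eval (hessian g u x) v)
  - xi * u x ^+ 2 * mx_eval (ricci g x) v.
Proof.
move=> n3 Uo Ux su gu gs gv eqn.
have N2 : n%:R - 2 != 0 :> R.
  by rewrite subr_eq0 (eqr_nat R n 2); case: (n) n3 => [|[|[|]]].
have boxE : box g u x = - ((m ^+ 2 + xi * scalar_curv g x) * u x).
  by apply/eqP; rewrite -addr_eq0 eqn.
rewrite /stress /einstein (hessian_sqr Uo Ux su).
have box2E : box g (fun y => u y ^+ 2) x =
    2 * u x * box g u x + 2 * grad2 g u x.
  by rewrite /box (hessian_sqr Uo Ux su) mtraceD !mtraceZ.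
rewrite box2E !(mx_evalD, mx_evalN, mx_evalZ) !(mtraceD, mtraceN, mtraceZ).
rewrite gv dprod_eval mtrace_metric// -/(scalar_curv g x) -/(box g u x).
rewrite -/(grad2 g u x) boxE.
by field.
Qed.

Lemma grad2_le (u : V -> R) (P : 'M[R]_n) x v : (0 < n)%N ->
  P \in unitmx -> P *m g x *m P^T = lorentz_sign R n -> mx_eval (g x) v = 1 ->
  grad2 g u x <= (\sum_k v 0 k * pd k u x) ^+ 2.
Proof.
move=> n0 Pu gP gv; pose w : 'rV[R]_n := \row_k pd k u x.
have := lorentz_covector_le w n0 Pu gP gv.
have -> : (w *m v^T) 0 0 = \sum_k v 0 k * pd k u x.
  by rewrite mxE; apply: eq_bigr => k _; rewrite !mxE mulrC.
suff -> : (w *m invmx (g x) *m w^T) 0 0 = grad2 g u x by [].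
rewrite -mx_evalE; apply: eq_bigr => a _; apply: eq_bigr => b _.
by rewrite !mxE mulrA.
Qed.

End StressTensor.

(** * Chart independence *)

Section ChartIndependence.
Variables (R : realType) (n : nat) (M : manifold R n) (g : lorentz_metric M).
Local Notation V := 'rV[R]_n.

Lemma metric_smooth_mx c : smooth_mx (chart_img c) (g c).
Proof. by move=> a b; exact: metric_smooth. Qed.

Lemma metric_unit c x : chart_img c x -> g c x \in unitmx.
Proof.
move=> cx; have [P Pu gP] := metric_signature g cx.
have : P *m g c x *m P^T \in unitmx.
  by rewrite gP; case: (mulmx1_unit (lorentz_sign_sqr R n)).
by rewrite !unitmx_mul => /andP[/andP[]].
Qed.

Definition overlap (c d : chart M) : set V :=
  chart_map c @` (chart_dom c `&` chart_dom d).

Definition transition (c d : chart M) : V -> V := chart_map d \o chart_inv c.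

Lemma overlap_open c d : open (overlap c d).
Proof.
rewrite openE => _ [p [cp dp] <-].
(* [chart_inv c] is a total function with meaningless values off the image of the chart, so nearby
   points must be kept inside that image as well. *)
have near_img : nbhs (chart_map c p) (chart_img c).
  apply: open_nbhs_nbhs; split; first exact: chart_img_open.
  by exists p.
have near_dom : nbhs (chart_map c p) (chart_inv c @^-1` chart_dom d).
  apply: (chart_inv_continuous cp); rewrite chart_mapK//.
  by apply: open_nbhs_nbhs; split => //; exact: chart_dom_open.
apply: filterS2 near_img near_dom => _ [q cq <-] /=; rewrite chart_mapK// => dq.
by exists q.
Qed.

Lemma overlap_sub c d x : overlap c d x -> chart_img c x.
Proof. by case=> p [cp _] <-; exists p. Qed.

Lemma transition_maps c d x : overlap c d x -> chart_img d (transition c d x).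
Proof. by case=> p [cp dp] <-; exists p => //; rewrite /transition /= chart_mapK. Qed.

Lemma transition_smooth c d : smooth_on (overlap c d) (transition c d).
Proof. exact: chart_compatible. Qed.

Lemma metric_overlap c d : smooth_mx (overlap c d) (g c).
Proof. by move=> a b s x /overlap_sub; exact: metric_smooth. Qed.

Lemma metric_pullback c d x : overlap c d x -> g c x =
  jac (transition c d) x *m g d (transition c d x) *m (jac (transition c d) x)^T.
Proof.
move=> cdx; rewrite -(jacobianE (smooth_on_differentiable (@transition_smooth c d) cdx)).
case: cdx => p [cp dp] <-; rewrite (metric_transition g cp dp).
by rewrite /transition /= chart_mapK.
Qed.

Lemma in_overlap c d p : chart_dom c p -> chart_dom d p -> overlap c d (chart_map c p).
Proof. by move=> cp dp; exists p. Qed.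

Lemma transitionE c d p : chart_dom c p ->
  transition c d (chart_map c p) = chart_map d p.
Proof. by move=> cp; rewrite /transition /= chart_mapK. Qed.

Lemma scalar_curv_chart c d p : chart_dom c p -> chart_dom d p ->
  scalar_curv (g c) (chart_map c p) = scalar_curv (g d) (chart_map d p).
Proof.
move=> cp dp; rewrite -(transitionE d cp).
exact: (scalar_curv_transform (@overlap_open c d) (@chart_img_open _ _ M d)
  (@transition_smooth c d) (@transition_maps c d) (@metric_overlap c d)
  (@metric_smooth_mx d) (fun x cdx => metric_unit (overlap_sub cdx))
  (@metric_unit d) (@Defs.metric_sym _ _ _ g d) (@metric_pullback c d) (in_overlap cp dp)).
Qed.

Lemma ricci_chart c d p : chart_dom c p -> chart_dom d p ->
  let J := jac (transition c d) (chart_map c p) in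
  ricci (g c) (chart_map c p) = J *m ricci (g d) (chart_map d p) *m J^T.
Proof.
move=> cp dp J; rewrite -(transitionE d cp).
exact: (ricci_transform (@overlap_open c d) (@chart_img_open _ _ M d)
  (@transition_smooth c d) (@transition_maps c d) (@metric_overlap c d)
  (@metric_smooth_mx d) (fun x cdx => metric_unit (overlap_sub cdx))
  (@metric_unit d) (@Defs.metric_sym _ _ _ g d) (@metric_pullback c d) (in_overlap cp dp)).
Qed.

Lemma in_chart_overlap (phi : M -> R) c d x : overlap c d x ->
  in_chart phi c x = in_chart phi d (transition c d x).
Proof.
by case=> p [cp dp] <-; rewrite /in_chart /= transitionE// !chart_mapK.
Qed.

Lemma grad2_chart (phi : M -> R) c d p : smooth_fun phi ->
  chart_dom c p -> chart_dom d p ->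
  grad2 (g c) (in_chart phi c) (chart_map c p) =
  grad2 (g d) (in_chart phi d) (chart_map d p).
Proof.
move=> sphi cp dp; rewrite -(transitionE d cp).
have cdx := in_overlap cp dp.
rewrite -(grad2_transform (@transition_smooth c d)
  (@transition_maps c d) (fun x cdx => metric_unit (overlap_sub cdx))
  (@metric_pullback c d) cdx (sphi d)).
rewrite /grad2; congr mtrace; apply/matrixP => a b; rewrite !mxE.
(* The two coordinate expressions of [phi] agree on the overlap only; it is open, which suffices for
   derivatives. *)
have E k : pd k (in_chart phi c) (chart_map c p) =
    pd k (fun y => in_chart phi d (transition c d y)) (chart_map c p).
  apply: (eq_pd _ (@overlap_open c d) cdx) => y /set_mem; exact: in_chart_overlap.
by rewrite !E.
Qed.

Lemma chart_at_dom (p : M) : chart_dom (chart_at p) p.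
Proof. exact: (projT2 (cid (chart_cover p))). Qed.

End ChartIndependence.

(** * Geometric quantities along the geodesic *)

Section AlongCurve.
Variables (R : realType) (n : nat) (M : manifold R n) (g : lorentz_metric M).
Local Notation V := 'rV[R]_n.
Variables (I : set R) (gamma : R -> M).
Hypothesis I_open : open I.
Hypothesis gamma_smooth : smooth_curve I gamma.

Definition chart_time (c : chart M) : set R := I `&` gamma @^-1` chart_dom c.

Lemma chart_time_open c : open (chart_time c).
Proof.
rewrite openE => t [It ct].
have near_I : nbhs t I by apply: open_nbhs_nbhs.
have near_c : nbhs t (gamma @^-1` chart_dom c).
  apply: (gamma_smooth.1 t It); apply: open_nbhs_nbhs; split => //.
  exact: chart_dom_open.
exact: filterI.
Qed.

Lemma coord_curve_smooth c :
  smooth_on (chart_time c : set R^o) (chart_map c \o gamma : R^o -> V).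
Proof. exact: gamma_smooth.2. Qed.

Lemma chart_time_img c t : chart_time c t -> chart_img c (chart_map c (gamma t)).
Proof. by case=> _ ct; exists (gamma t). Qed.

Lemma along_smooth c (u : V -> R) : smooth_on (chart_img c) (u : _ -> R^o) ->
  smooth_on (chart_time c : set R^o) (fun t => u (chart_map c (gamma t)) : R^o).
Proof.
move=> su; apply: (smooth_on_comp _ _ (@coord_curve_smooth c) su).
- exact: chart_time_open.
- exact: chart_time_img.
Qed.

Lemma velocity_coordE c t k : chart_time c t ->
  velocity gamma c t 0 k = 'D_1 (fun s : R^o => chart_map c (gamma s) 0 k : R^o) t.
Proof.
move=> ct; have d := smooth_on_differentiable (@coord_curve_smooth c) ct.
by rewrite /velocity derive1E -(derive_coord (1 : R^o) k d).
Qed.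

Lemma velocity_coord_smooth c k :
  smooth_on (chart_time c : set R^o) (fun t => velocity gamma c t 0 k : R^o).
Proof.
have To := @chart_time_open c.
apply: (@eq_smooth_on _ _ _ _ ('D_1 (fun s : R^o => chart_map c (gamma s) 0 k : R^o))) => //.
  by move=> t /set_mem ct; rewrite velocity_coordE.
by apply: smooth_on_derive; exact: (smooth_on_coord k To (@coord_curve_smooth c)).
Qed.

Lemma derive_along c (u : V -> R) t : smooth_on (chart_img c) (u : _ -> R^o) ->
  chart_time c t ->
  'D_1 (fun s : R^o => u (chart_map c (gamma s)) : R^o) t =
  \sum_k velocity gamma c t 0 k * pd k u (chart_map c (gamma t)).
Proof.
move=> su ct.
have d1 := smooth_on_differentiable (@coord_curve_smooth c) ct.
have d2 := smooth_on_differentiable su (chart_time_img ct).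
rewrite (derive_chain (1 : R^o) d1 d2).
by apply: eq_bigr => k _; rewrite velocity_coordE.
Qed.

Lemma velocity_transform c d t : chart_time c t -> chart_time d t ->
  velocity gamma d t =
  velocity gamma c t *m jac (transition c d) (chart_map c (gamma t)).
Proof.
move=> ct dt.
have cdx : overlap c d (chart_map c (gamma t)) by exact: in_overlap ct.2 dt.2.
have d1 := smooth_on_differentiable (@coord_curve_smooth c) ct.
have d2 := smooth_on_differentiable (@transition_smooth _ _ _ c d) cdx.
rewrite -(jacobianE d2) -deriveEjacobian// /velocity !derive1E.
have -> : 'D_1 (chart_map d \o gamma) t =
    'D_1 (transition c d \o (chart_map c \o gamma)) t.
  apply: near_eq_derive; apply: filterS (open_nbhs_nbhs (conj (@chart_time_open c) ct)).
  by move=> s [_ cs]; rewrite /= transitionE.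
rewrite (deriveE (1 : R^o) (differentiable_comp d1 d2)) (diff_comp d1 d2) /=.
by rewrite (deriveE (1 : R^o) d1) (deriveE _ d2).
Qed.

Lemma ricci_along_chart c t : chart_time c t -> ricci_along g gamma t =
  mx_eval (ricci (g c) (chart_map c (gamma t))) (velocity gamma c t).
Proof.
move=> ct; pose d := chart_at (gamma t).
have dt : chart_time d t by split; [exact: ct.1|exact: chart_at_dom].
rewrite /ricci_along -/d (ricci_chart g ct.2 dt.2) (velocity_transform ct dt).
by rewrite !mx_evalE trmx_mul !mulmxA.
Qed.

Lemma scal_along_chart c t : chart_time c t ->
  scal g (gamma t) = scalar_curv (g c) (chart_map c (gamma t)).
Proof. by move=> ct; exact: (scalar_curv_chart g (chart_at_dom _) ct.2). Qed.

(** Here [q] is defined through a chart that varies with time, and [h] is its expression in the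
    fixed chart [c]; chart independence supplies their equality on the open set of times spent in
    [c]. *)
Lemma continuous_on_chart_time (q h : R -> R) c t : chart_time c t ->
  smooth_on (chart_time c : set R^o) (h : R^o -> R^o) ->
  (forall s, chart_time c s -> q s = h s) -> {for t, continuous q}.
Proof.
move=> ct sh qh.
have sq : smooth_on (chart_time c : set R^o) (q : R^o -> R^o).
  apply: (eq_smooth_on (@chart_time_open c) _ sh) => s /set_mem cs.
  by rewrite qh.
exact: (differentiable_continuous (smooth_on_differentiable sq ct)).
Qed.

Lemma ricci_along_continuous t : I t -> {for t, continuous (ricci_along g gamma)}.
Proof.
move=> It; pose c := chart_at (gamma t).
have ct : chart_time c t by split => //; exact: chart_at_dom.
have To := @chart_time_open c.
pose h s : R := \sum_a \sum_b ricci (g c) (chart_map c (gamma s)) a b *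
    velocity gamma c s 0 a * velocity gamma c s 0 b.
apply: (@continuous_on_chart_time _ h c t ct) => [|s cs]; last exact: ricci_along_chart.
apply: smooth_on_sum => // a; apply: smooth_on_sum => // b.
apply: smooth_onM => //; last exact: velocity_coord_smooth.
apply: smooth_onM => //; last exact: velocity_coord_smooth.
apply: (@along_smooth c (fun x => ricci (g c) x a b)).
have imgo : open (chart_img c) by exact: chart_img_open.
exact: (smooth_ricci imgo (@metric_smooth_mx _ _ _ g c) (@metric_unit _ _ _ g c) a b).
Qed.

Lemma scal_along_continuous t : I t -> {for t, continuous (fun s => scal g (gamma s))}.
Proof.
move=> It; pose c := chart_at (gamma t).
have ct : chart_time c t by split => //; exact: chart_at_dom.
have To := @chart_time_open c.
have imgo : open (chart_img c) by exact: chart_img_open.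
pose h s : R := scalar_curv (g c) (chart_map c (gamma s)).
apply: (@continuous_on_chart_time _ h c t ct) => [|s cs]; last exact: scal_along_chart.
apply: (@along_smooth c (scalar_curv (g c))).
have sg := @metric_smooth_mx _ _ _ g c; have ug := @metric_unit _ _ _ g c.
apply: smooth_on_sum => // a; apply: smooth_on_sum => // b.
apply: smooth_onM => //; first exact: smooth_on_invmx.
exact: smooth_ricci.
Qed.

Variable phi : M -> R.
Hypothesis phi_smooth : smooth_fun phi.

(** Uses the same chart as [eff_density], so that the pointwise formula applies literally. *)
Definition grad2_along (t : R) : R :=
  let c := chart_at (gamma t) in
  grad2 (g c) (in_chart phi c) (chart_map c (gamma t)).

Lemma grad2_along_continuous t : I t -> {for t, continuous grad2_along}.
Proof.
move=> It; pose c := chart_at (gamma t).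
have ct : chart_time c t by split => //; exact: chart_at_dom.
have To := @chart_time_open c.
have imgo : open (chart_img c) by exact: chart_img_open.
pose h s : R := grad2 (g c) (in_chart phi c) (chart_map c (gamma s)).
apply: (@continuous_on_chart_time _ h c t ct) => [|s cs]; last first.
  exact: (grad2_chart g phi_smooth (chart_at_dom _) cs.2).
apply: (@along_smooth c (grad2 (g c) (in_chart phi c))).
have sg := @metric_smooth_mx _ _ _ g c; have ug := @metric_unit _ _ _ g c.
apply: smooth_on_sum => // a; apply: smooth_on_sum => // b.
apply: smooth_onM => //; first exact: smooth_on_invmx.
rewrite (_ : (fun _ => _) = fun y =>
    pd a (in_chart phi c) y * pd b (in_chart phi c) y : R^o); last first.
  by apply/funext => y; rewrite mxE.
by apply: smooth_onM => //; apply: smooth_on_derive; exact: phi_smooth.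
Qed.

Lemma field_alongE c t : chart_time c t ->
  phi (gamma t) = in_chart phi c (chart_map c (gamma t)).
Proof. by case=> _ ct; rewrite /in_chart /= chart_mapK. Qed.

Lemma field_along_smooth : smooth_on (I : set R^o) (phi \o gamma : R^o -> R^o).
Proof.
move=> s t It; pose c := chart_at (gamma t).
have ct : chart_time c t by split => //; exact: chart_at_dom.
suff : smooth_on (chart_time c : set R^o) (phi \o gamma : R^o -> R^o) by apply.
apply: (@eq_smooth_on _ _ _ _ (fun s : R^o =>
  in_chart phi c (chart_map c (gamma s)) : R^o)).
- exact: chart_time_open.
- by move=> r /set_mem cr; rewrite /= (field_alongE cr).
- by apply: along_smooth; exact: phi_smooth.
Qed.

Lemma derive_field_along c t : chart_time c t ->
  'D_1 (phi \o gamma : R^o -> R^o) t =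
  \sum_k velocity gamma c t 0 k * pd k (in_chart phi c) (chart_map c (gamma t)).
Proof.
move=> ct; rewrite -(derive_along (@phi_smooth c) ct).
apply: near_eq_derive; apply: filterS (open_nbhs_nbhs (conj (@chart_time_open c) ct)).
by move=> r cr; rewrite /= (field_alongE cr).
Qed.

Hypothesis gamma_geodesic : geodesic g I gamma.

(* The geodesic equation turns the second derivative along the curve into the
   covariant Hessian evaluated on the velocity. *)
Lemma derive2_field_along c t : chart_time c t ->
  'D_1 ('D_1 (phi \o gamma : R^o -> R^o)) t =
  mx_eval (hessian (g c) (in_chart phi c) (chart_map c (gamma t)))
    (velocity gamma c t).
Proof.
move=> ct; have To := @chart_time_open c.
set u := in_chart phi c.
have su : smooth_on (chart_img c) (u : _ -> R^o) by exact: phi_smooth.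
have spd k : smooth_on (chart_img c) (pd k u : _ -> R^o) by exact: smooth_on_derive.
have dv k : differentiable (fun s => velocity gamma c s 0 k : R^o) (t : R^o).
  exact: smooth_on_differentiable (@velocity_coord_smooth c k) ct.
have du k : differentiable (fun s => pd k u (chart_map c (gamma s)) : R^o) (t : R^o).
  exact: smooth_on_differentiable (along_smooth (spd k)) ct.
transitivity ('D_1 (fun s : R^o => \sum_k velocity gamma c s 0 k *
    pd k u (chart_map c (gamma s)) : R^o) t).
  apply: near_eq_derive; apply: filterS (open_nbhs_nbhs (conj To ct)).
  by move=> r cr; rewrite (derive_field_along cr).
rewrite derive_bigsum => [|k]; last exact: differentiableM.
set x := chart_map c (gamma t).
have accel k : 'D_1 (fun s : R^o => velocity gamma c s 0 k : R^o) t =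
    - mx_eval (\matrix_(a, b) christoffel (g c) k a b x) (velocity gamma c t).
  apply/eqP; rewrite -addr_eq0 -(gamma_geodesic.2 c t ct.1 ct.2 k); apply/eqP.
  congr (_ + _).
  have dvel : derivable (velocity gamma c) t 1.
    apply/derivable_mxP => i j; rewrite (ord1 i).
    exact: (diff_derivable (dv j)).
  by rewrite derive1E (derive_mx dvel) mxE.
transitivity (\sum_k (- mx_eval (\matrix_(a, b) christoffel (g c) k a b x)
    (velocity gamma c t) * pd k u x + velocity gamma c t 0 k *
    \sum_j velocity gamma c t 0 j * pd j (pd k u) x)).
  by apply: eq_bigr => k _; rewrite derive_mul// accel (derive_along (spd k) ct).
set v := velocity gamma c t.
rewrite big_split /= addrC.
(* The split mirrors the product rule: the second partials come from differentiating [pd k u] along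
   the curve, the Christoffel part from the acceleration. *)
have -> : hessian (g c) u x = (\matrix_(a, b) pd a (pd b u) x)
    + \sum_k (- pd k u x) *: (\matrix_(a, b) christoffel (g c) k a b x).
  apply/matrixP => a b; rewrite !mxE summxE -sumrN; congr (_ + _).
  by apply: eq_bigr => k _; rewrite !mxE mulNr mulrC.
rewrite mx_evalD; congr (_ + _).
  rewrite /mx_eval exchange_big; apply: eq_bigr => k _.
  by rewrite mulr_sumr; apply: eq_bigr => j _; rewrite mxE; ring.
rewrite (big_morph (fun S => mx_eval S v) (fun S T => mx_evalD S T v) (id1 := 0)).
  by apply: eq_bigr => k _; rewrite mx_evalZ mulNr mulrC mulNr.
by rewrite mx_evalE mulmx0 mul0mx mxE.
Qed.

Hypothesis gamma_proper : proper_time g I gamma.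

Lemma grad2_along_le t : (0 < n)%N -> I t ->
  grad2_along t <= ('D_1 (phi \o gamma : R^o -> R^o) t) ^+ 2.
Proof.
move=> n0 It; pose c := chart_at (gamma t).
have ct : chart_time c t by split => //; exact: chart_at_dom.
have [P Pu gP] := metric_signature g (chart_time_img ct).
rewrite (derive_field_along ct).
exact: (grad2_le _ n0 Pu gP (gamma_proper It ct.2)).
Qed.

(** Everything takes place in the chart selected at [gamma t]; the derivatives of [phi \o gamma] on
    the right no longer depend on it. *)
Lemma eff_density_along (m xi : R) t : (3 <= n)%N -> field_solution g m xi phi -> I t ->
  eff_density g gamma m xi phi t =
  ('D_1 (phi \o gamma : R^o -> R^o) t) ^+ 2
  - (1 - 2 * xi) / (n%:R - 2) * m ^+ 2 * phi (gamma t) ^+ 2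
  + 2 * xi ^+ 2 / (n%:R - 2) * scal g (gamma t) * phi (gamma t) ^+ 2
  - 2 * xi / (n%:R - 2) * grad2_along t
  - 2 * xi * (('D_1 (phi \o gamma : R^o -> R^o) t) ^+ 2 +
      phi (gamma t) * 'D_1 ('D_1 (phi \o gamma : R^o -> R^o)) t)
  - xi * phi (gamma t) ^+ 2 * ricci_along g gamma t.
Proof.
move=> n3 sol It; pose c := chart_at (gamma t).
have ct : chart_time c t by split => //; exact: chart_at_dom.
have cx := chart_time_img ct.
have imgo : open (chart_img c) by exact: chart_img_open.
have := sol (gamma t); rewrite /wave_op {1}(field_alongE ct) => eqn.
have := eff_density_formula n3 imgo cx (@phi_smooth c) (metric_unit g cx)
  (Defs.metric_sym g cx) (gamma_proper It ct.2) eqn.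
rewrite -(derive_field_along ct) -(derive2_field_along ct) -(field_alongE ct).
by [].
Qed.

End AlongCurve.

(** * Integration along the curve *)

Section CompactlySupportedIntegrals.
Variables (R : realType) (I : set R).
Hypothesis I_open : open I.
Hypothesis I_interval : is_interval I.

Local Notation mu := (@lebesgue_measure R).

(** Openness of [I] leaves a margin beyond the extreme points of [K], so the endpoints can be taken
    strictly outside [K] and still in [I]. *)
Lemma compact_in_open_interval (K : set R) : I !=set0 -> compact K -> K `<=` I ->
  exists a b, [/\ a < b, I a, I b & forall t, K t -> a < t < b].
Proof.
(* Adjoining a point of [I] provides extreme points even when [K] is empty. *)
move=> [t0 It0] cK KI; pose L := K `|` [set t0].
have cL : compact L by apply: compactU => //; exact: compact_set1.
have L0 : L !=set0 by exists t0; right.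
have LI : L `<=` I by move=> t [/KI//|->].
have cid : {within L, continuous (idfun : R -> R)}.
  by apply: continuous_subspaceT => t; exact: cvg_id.
have [c /set_mem Lc cmax] := compact_EVT_max L0 cL cid.
have [d /set_mem Ld dmin] := compact_EVT_min L0 cL cid.
have margin t : I t -> exists2 e : R, 0 < e & I (t - e) /\ I (t + e).
  move=> It; have /nbhs_ballP[e /= e0 te] := open_nbhs_nbhs (conj I_open It).
  exists (e / 2); first by rewrite divr_gt0.
  have e2 : `|e / 2| < e by rewrite gtr0_norm ?divr_gt0// ltr_pdivrMr// ltr_pMr// ltr1n.
  split; apply: te; rewrite -ball_normE /=.
    by rewrite opprB addrC subrK.
  by rewrite opprD addrA subrr sub0r normrN.
have [e1 e10 [Ide1 _]] := margin d (LI _ Ld).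
have [e2 e20 [_ Ice2]] := margin c (LI _ Lc).
have dc : d <= c by apply: dmin; exact/mem_set.
exists (d - e1), (c + e2); split => //.
  by rewrite (@lt_trans _ _ d) ?ltrBlDr ?ltrDl// (le_lt_trans dc)// ltrDl.
move=> t Kt; have Lt : t \in L by apply/mem_set; left.
apply/andP; split.
  by apply: lt_le_trans (dmin _ Lt); rewrite ltrBlDr ltrDl.
by apply: le_lt_trans (cmax _ Lt) _; rewrite ltrDl.
Qed.

Variables a b : R.
Hypothesis ab : a < b.
Hypothesis Ia : I a.
Hypothesis Ib : I b.

Lemma segment_subset : `[a, b]%classic `<=` I.
Proof.
by move=> t /=; rewrite in_itv /=; exact: I_interval.
Qed.

Lemma measurable_I : measurable (I : set (measurableTypeR R)).
Proof. exact: measurable_realfun.open_measurable. Qed.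

Lemma segment_continuous (h : R -> R) : (forall t, I t -> {for t, continuous h}) ->
  {within `[a, b], continuous h}.
Proof.
move=> ch; apply: continuous_in_subspaceT => t /set_mem tab.
by apply: ch; exact: segment_subset.
Qed.

Lemma restrict_segmentE (h : R -> R) :
  (forall t, I t -> ~ `[a, b]%classic t -> h t = 0) ->
  {in I, h =1 h \_ `[a, b]}.
Proof.
move=> h0 t /set_mem It; rewrite patchE; case: ifPn => // /negP nt.
by apply: h0 => // tab; apply: nt; exact/mem_set.
Qed.

(** Continuity on the open set [I] gives no bound near its ends; vanishing off [[a, b]] reduces the
    claim to a continuous function on a compact segment. *)
Lemma integrable_segment_supported (h : R -> R) :
  (forall t, I t -> {for t, continuous h}) ->
  (forall t, I t -> ~ `[a, b]%classic t -> h t = 0) ->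
  mu.-integrable I (EFin \o h).
Proof.
move=> ch h0; have mab : measurable (`[a, b]%classic : set (measurableTypeR R)) by [].
have : mu.-integrable (I `&` `[a, b]) (EFin \o h).
  rewrite (setIidr segment_subset).
  apply: continuous_compact_integrable; first exact: segment_compact.
  exact: segment_continuous.
move=> /(integrable_restrict mu mab measurable_I) iI.
refine (eq_integrable measurable_I _ _ _ iI) => t It.
by rewrite restrict_EFin /= (restrict_segmentE h0 It).
Qed.

Lemma Rintegral_derive_supported (F h : R -> R) :
  (forall t, I t -> is_derive t 1 F (h t)) ->
  (forall t, I t -> {for t, continuous h}) ->
  (forall t, I t -> ~ `[a, b]%classic t -> h t = 0) ->
  F a = 0 -> F b = 0 ->
  \int[mu]_(t in I) h t = 0.
Proof.
move=> dF ch h0 Fa Fb.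
have cF t : I t -> {for t, continuous F}.
  by move=> /dF[dFt _]; apply/differentiable_continuous/derivable1_diffP.
transitivity (\int[mu]_(t in I) (h \_ `[a, b]) t).
  by apply: eq_Rintegral; exact: restrict_segmentE.
rewrite -Rintegral_mkcondr (setIidr segment_subset).
rewrite /Rintegral (@continuous_FTC2 _ h F a b ab).
- by rewrite Fa Fb -EFinB subrr.
- exact: segment_continuous.
- split.
  + move=> t; rewrite in_itv /= => /andP[ta tb].
    have /dF[] // : I t by apply: segment_subset; rewrite /= in_itv /= !ltW.
  + by apply: cvg_at_right_filter; exact: cF.
  + by apply: cvg_at_left_filter; exact: cF.
- move=> t; rewrite in_itv /= => /andP[ta tb].
  have /dF[_ <-] : I t by apply: segment_subset; rewrite /= in_itv /= !ltW.
  by rewrite derive1E.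
Qed.

End CompactlySupportedIntegrals.

(** * Pointwise nonnegativity of the weighted energy *)

Section WeightedEnergy.
Variable R : realType.

(** Completing the square with the cross term [4 xi f f1 p p1] costs [2 xi (f p1)^2], and replacing
    [G] by [p1 ^+ 2] costs [2 xi / (N - 2) (f p1)^2]. Together these make up
    [2 xi (N - 1) / (N - 2)]. *)
Lemma energy_coercive (N m xi f f1 p p1 p2 G Rc S : R) : 2 < N -> 0 <= xi ->
  xi <= 2 * ((N - 2) / (4 * (N - 1))) -> G <= p1 ^+ 2 ->
  0 <= (p1 ^+ 2 - (1 - 2 * xi) / (N - 2) * m ^+ 2 * p ^+ 2
         + 2 * xi ^+ 2 / (N - 2) * S * p ^+ 2 - 2 * xi / (N - 2) * G
         - 2 * xi * (p1 ^+ 2 + p * p2) - xi * p ^+ 2 * Rc) * f ^+ 2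
     + ((1 - 2 * xi) / (N - 2) * m ^+ 2 * f ^+ 2
         + xi * (2 * f1 ^+ 2 + Rc * f ^+ 2 - 2 * xi / (N - 2) * S * f ^+ 2)) * p ^+ 2
     + xi * (2 * f * f1 * (2 * (p * p1)) + f ^+ 2 * (2 * (p1 * p1 + p * p2))).
Proof.
move=> N2 xi0 xiN Gp; have K0 : 0 < N - 2 by rewrite subr_gt0.
have N1 : 0 < N - 1 by lra.
have -> : (p1 ^+ 2 - (1 - 2 * xi) / (N - 2) * m ^+ 2 * p ^+ 2
         + 2 * xi ^+ 2 / (N - 2) * S * p ^+ 2 - 2 * xi / (N - 2) * G
         - 2 * xi * (p1 ^+ 2 + p * p2) - xi * p ^+ 2 * Rc) * f ^+ 2
     + ((1 - 2 * xi) / (N - 2) * m ^+ 2 * f ^+ 2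
         + xi * (2 * f1 ^+ 2 + Rc * f ^+ 2 - 2 * xi / (N - 2) * S * f ^+ 2)) * p ^+ 2
     + xi * (2 * f * f1 * (2 * (p * p1)) + f ^+ 2 * (2 * (p1 * p1 + p * p2))) =
  (1 - 2 * xi * (N - 1) / (N - 2)) * (f * p1) ^+ 2
  + 2 * xi / (N - 2) * f ^+ 2 * (p1 ^+ 2 - G) + 2 * xi * (f * p1 + f1 * p) ^+ 2.
  by field; rewrite gt_eqF.
(* This is the upper bound on [xi] with its denominators cleared; the threshold [2 xi_c] is exactly
   where the coefficient vanishes. *)
have xiN' : 0 <= 1 - 2 * xi * (N - 1) / (N - 2).
  rewrite subr_ge0 ler_pdivrMr// mul1r.
  have : xi * (4 * (N - 1)) <= 2 * (N - 2).
    by rewrite -ler_pdivlMr ?mulr_gt0// -mulrA.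
  by nra.
have t1 := mulr_ge0 xiN' (sqr_ge0 (f * p1)).
have t2 : 0 <= 2 * xi / (N - 2) * f ^+ 2 * (p1 ^+ 2 - G).
  by rewrite mulr_ge0 ?subr_ge0// mulr_ge0 ?sqr_ge0// divr_ge0 ?(ltW K0)// mulr_ge0.
have t3 : 0 <= 2 * xi * (f * p1 + f1 * p) ^+ 2.
  by rewrite mulr_ge0 ?sqr_ge0// mulr_ge0.
exact: addr_ge0 (addr_ge0 t1 t2) t3.
Qed.

End WeightedEnergy.

(** * The integrated inequality for functions of one real variable *)

Section EnergyInequality.
Variable R : realType.

(** A named head symbol for pointwise continuity, on which the tactic [continuity] can match. *)
Definition cont_at (t : R) (h : R -> R) : Prop := {for t, continuous h}.

Lemma cont_at_add t (h k : R -> R) : cont_at t h -> cont_at t k ->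
  cont_at t (fun s => h s + k s).
Proof. by move=> ch ck; exact: cvgD ch ck. Qed.

Lemma cont_at_mul t (h k : R -> R) : cont_at t h -> cont_at t k ->
  cont_at t (fun s => h s * k s).
Proof. by move=> ch ck; exact: cvgM ch ck. Qed.

Lemma cont_at_opp t (h : R -> R) : cont_at t h -> cont_at t (fun s => - h s).
Proof. by move=> ch; exact: cvgN ch. Qed.

Lemma cont_at_sqr t (h : R -> R) : cont_at t h -> cont_at t (fun s => h s ^+ 2).
Proof. by move=> ch; exact: cont_at_mul. Qed.

Lemma cont_at_cst t (k : R) : cont_at t (fun=> k).
Proof. exact: cvg_cst. Qed.

Ltac continuity := repeat lazymatch goal with
  | |- cont_at _ (fun _ => ?k) => exact (@cont_at_cst _ k)
  | |- cont_at _ (fun s => @?h s + @?k s) => refine (@cont_at_add _ h k _ _)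
  | |- cont_at _ (fun s => - @?h s) => refine (@cont_at_opp _ h _)
  | |- cont_at _ (fun s => @?h s ^+ 2) => refine (@cont_at_sqr _ h _)
  | |- cont_at _ (fun s => @?h s * @?k s) => refine (@cont_at_mul _ h k _ _)
  | |- cont_at _ _ => assumption
  end.

Lemma energy_integrand_continuous (f psi p1 p2 G Rc S : R -> R) (c1 c2 c3 c4 c5 t : R) :
  cont_at t f -> cont_at t psi -> cont_at t p1 -> cont_at t p2 ->
  cont_at t G -> cont_at t Rc -> cont_at t S ->
  cont_at t (fun s => (p1 s ^+ 2 - c1 * psi s ^+ 2 + c2 * S s * psi s ^+ 2
    - c3 * G s - c4 * (p1 s ^+ 2 + psi s * p2 s) - c5 * psi s ^+ 2 * Rc s) * f s ^+ 2).
Proof. by move=> *; continuity. Qed.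

Lemma bound_integrand_continuous (f f1 psi Rc S : R -> R) (c1 c2 c3 t : R) :
  cont_at t f -> cont_at t f1 -> cont_at t psi -> cont_at t Rc -> cont_at t S ->
  cont_at t (fun s => (c1 * f s ^+ 2
    + c2 * (2 * f1 s ^+ 2 + Rc s * f s ^+ 2 - c3 * S s * f s ^+ 2)) * psi s ^+ 2).
Proof. by move=> *; continuity. Qed.

Lemma boundary_integrand_continuous (f f1 psi p1 p2 : R -> R) (t : R) :
  cont_at t f -> cont_at t f1 -> cont_at t psi -> cont_at t p1 -> cont_at t p2 ->
  cont_at t (fun s => 2 * f s * f1 s * (2 * (psi s * p1 s))
    + f s ^+ 2 * (2 * (p1 s * p1 s + psi s * p2 s))).
Proof. by move=> *; continuity. Qed.

(** The complement of the closed support is open, so [f] vanishes on a whole neighbourhood of [t],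
    and its derivative with it. *)
Lemma notin_tsupport (f : R -> R) t : ~ tsupport f t -> f t = 0 /\ f^`()%classic t = 0.
Proof.
move=> nt; have near0 : \near t, f t = cst 0 t.
  have /open_nbhs_nbhs : open_nbhs t (~` tsupport f).
    by split => //; exact/closed_openC/closed_closure.
  apply: filterS => s ns; apply: contrapT => fs; apply: ns.
  by apply: subset_closure; apply/eqP.
split; first exact: (nbhs_singleton near0).
by rewrite derive1E (near_eq_derive (1 : R^o) near0) derive_cst.
Qed.

Variable I : set R.
Hypothesis I_open : open I.
Hypothesis I_interval : is_interval I.
Variables (f psi G Rc S : R -> R) (N m xi : R).
Hypothesis f_C2 : C2 f.
Hypothesis f_compact : compact (tsupport f).
Hypothesis f_supp : tsupport f `<=` I.
Hypothesis psi_smooth : smooth_on (I : set R^o) (psi : R^o -> R^o).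
Hypothesis G_continuous : forall t, I t -> {for t, continuous G}.
Hypothesis Rc_continuous : forall t, I t -> {for t, continuous Rc}.
Hypothesis S_continuous : forall t, I t -> {for t, continuous S}.
Hypothesis N_gt2 : 2 < N.
Hypothesis xi_ge0 : 0 <= xi.
Hypothesis xi_le : xi <= 2 * ((N - 2) / (4 * (N - 1))).

Let p1 : R -> R := 'D_1 (psi : R^o -> R^o).
Let p2 : R -> R := 'D_1 ('D_1 (psi : R^o -> R^o)).
Let f1 := derive1 f.

Hypothesis G_le : forall t, I t -> G t <= p1 t ^+ 2.

Let rho t := p1 t ^+ 2 - (1 - 2 * xi) / (N - 2) * m ^+ 2 * psi t ^+ 2
  + 2 * xi ^+ 2 / (N - 2) * S t * psi t ^+ 2 - 2 * xi / (N - 2) * G t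
  - 2 * xi * (p1 t ^+ 2 + psi t * p2 t) - xi * psi t ^+ 2 * Rc t.

Lemma energy_inequality :
  \int[lebesgue_measure]_(t in I) (rho t * f t ^+ 2) >=
  - \int[lebesgue_measure]_(t in I)
      (((1 - 2 * xi) / (N - 2) * m ^+ 2 * f t ^+ 2
        + xi * (2 * f1 t ^+ 2 + Rc t * f t ^+ 2
                - 2 * xi / (N - 2) * S t * f t ^+ 2)) * psi t ^+ 2).
Proof.
(* An empty [I] offers no endpoints [a], [b]; both integrals are then zero. *)
have [->|/set0P I0] := eqVneq I set0; first by rewrite !Rintegral_set0 oppr0.
have [a [b [ab Ia Ib Kab]]] :=
  compact_in_open_interval I_open I0 f_compact f_supp.
have fout t : ~ `[a, b]%classic t -> f t = 0 /\ f1 t = 0.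
  move=> nt; apply: notin_tsupport => Kt; apply: nt.
  by have /andP[ta tb] := Kab t Kt; rewrite /= in_itv /= !ltW.
have fend t : t = a \/ t = b -> f t = 0.
  move=> tE; have nt : ~ tsupport f t.
    by move=> /Kab; case: tE => ->; rewrite ltxx ?andbF.
  by have [] := notin_tsupport nt.
have [df df1 _] := f_C2.
have cf : forall t, {for t, continuous f} by move=> t; apply/differentiable_continuous/derivable1_diffP.
have cf1 : forall t, {for t, continuous f1} by move=> t; apply/differentiable_continuous/derivable1_diffP.
have sp1 := smooth_on_derive (1 : R^o) psi_smooth.
have sp2 := smooth_on_derive (1 : R^o) sp1.
have cp : forall t, I t -> {for t, continuous psi}.
  by move=> t It; exact: (differentiable_continuous (smooth_on_differentiable psi_smooth It)).
have cp1 : forall t, I t -> {for t, continuous p1}.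
  by move=> t It; exact: (differentiable_continuous (smooth_on_differentiable sp1 It)).
have cp2 : forall t, I t -> {for t, continuous p2}.
  by move=> t It; exact: (differentiable_continuous (smooth_on_differentiable sp2 It)).
pose A t := rho t * f t ^+ 2.
pose B t := ((1 - 2 * xi) / (N - 2) * m ^+ 2 * f t ^+ 2
  + xi * (2 * f1 t ^+ 2 + Rc t * f t ^+ 2
          - 2 * xi / (N - 2) * S t * f t ^+ 2)) * psi t ^+ 2.
(* [F] is [f^2 (psi^2)'] and [h] its derivative. [F] vanishes at [a] and [b], which lie outside the
   support of [f]. *)
pose F t := f t ^+ 2 * (2 * (psi t * p1 t)).
pose h t := 2 * f t * f1 t * (2 * (psi t * p1 t))
  + f t ^+ 2 * (2 * (p1 t * p1 t + psi t * p2 t)).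
have cA : forall t, I t -> {for t, continuous A}.
  move=> t It; have cE := @energy_integrand_continuous f psi p1 p2 G Rc S
    ((1 - 2 * xi) / (N - 2) * m ^+ 2) (2 * xi ^+ 2 / (N - 2)) (2 * xi / (N - 2))
    (2 * xi) xi t (cf t) (cp t It) (cp1 t It) (cp2 t It) (G_continuous It)
    (Rc_continuous It) (S_continuous It).
  exact: cE.
have cB : forall t, I t -> {for t, continuous B}.
  move=> t It; have cE := @bound_integrand_continuous f f1 psi Rc S
    ((1 - 2 * xi) / (N - 2) * m ^+ 2) xi (2 * xi / (N - 2)) t
    (cf t) (cf1 t) (cp t It) (Rc_continuous It) (S_continuous It).
  exact: cE.
have ch : forall t, I t -> {for t, continuous h}.
  move=> t It; exact: (boundary_integrand_continuous (cf t) (cf1 t) (cp t It)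
    (cp1 t It) (cp2 t It)).
have A0 t : I t -> ~ `[a, b]%classic t -> A t = 0.
  by move=> _ /fout[f0 _]; rewrite /A f0 expr0n mulr0.
have B0 t : I t -> ~ `[a, b]%classic t -> B t = 0.
  by move=> _ /fout[f0 f10]; rewrite /B f0 f10 expr0n /= !mulr0 !addr0 oppr0 addr0 !mulr0 addr0 mul0r.
have h0 t : I t -> ~ `[a, b]%classic t -> h t = 0.
  by move=> _ /fout[f0 f10]; rewrite /h f0 f10 expr0n /= !mulr0 !mul0r addr0.
have dF t : I t -> is_derive t 1 F (h t).
  move=> It.
  have dft : differentiable (f : R^o -> R^o) t by apply/derivable1_diffP.
  have dpt := smooth_on_differentiable psi_smooth It.
  have dp1t := smooth_on_differentiable sp1 It.
  have dff : differentiable (fun s => f s ^+ 2 : R^o) (t : R^o).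
    by apply: differentiableM.
  have dpp : differentiable (fun s => psi s * p1 s : R^o) (t : R^o).
    by apply: differentiableM.
  have d2pp : differentiable (fun s => 2 * (psi s * p1 s) : R^o) (t : R^o).
    by apply: differentiableM => //; exact: differentiable_cst.
  have dFt : differentiable (F : R^o -> R^o) t by exact: differentiableM.
  apply: DeriveDef; first exact/derivable1_diffP.
  rewrite /F (derive_mul (1 : R^o) dff d2pp).
  rewrite (derive_mul (1 : R^o) (differentiable_cst (2 : R^o) (t : R^o)) dpp).
  rewrite (derive_mul (1 : R^o) dpt dp1t) (derive_mul (1 : R^o) dft dft).
  rewrite derive_cst mul0r add0r /h /f1 derive1E; congr (_ * _ + _).
  by rewrite [X in _ + X]mulrC; ring.
have mI := measurable_I I_open.
have iA := integrable_segment_supported I_open I_interval Ia Ib cA A0.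
have iB := integrable_segment_supported I_open I_interval Ia Ib cB B0.
have ih := integrable_segment_supported I_open I_interval Ia Ib ch h0.
have int_h := Rintegral_derive_supported I_interval ab Ia Ib dF ch h0.
have {int_h} int_h : \int[lebesgue_measure]_(t in I) h t = 0.
  by apply: int_h; rewrite /F fend ?expr0n ?mul0r//; [left|right].
have xih0 t : I t -> ~ `[a, b]%classic t -> - xi * h t = 0.
  by move=> It nt; rewrite h0// mulr0.
have cxih : forall t, I t -> {for t, continuous (fun s => - xi * h s)}.
  move=> t It; have cE := @cont_at_mul t _ h (@cont_at_cst t (- xi)) (ch t It).
  exact: cE.
have ixih := integrable_segment_supported I_open I_interval Ia Ib cxih xih0.
have cAB : forall t, I t -> {for t, continuous (fun s => A s + B s)}.
  move=> t It; have cE := @cont_at_add t A B (cA t It) (cB t It).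
  exact: cE.
have AB0 t : I t -> ~ `[a, b]%classic t -> A t + B t = 0.
  by move=> It nt; rewrite A0// B0// addr0.
have iAB := integrable_segment_supported I_open I_interval Ia Ib cAB AB0.
rewrite -subr_ge0 opprK -(RintegralD mI iA iB).
(* Zero is written as the integral of [- xi * h], which turns the comparison of integrals into the
   pointwise bound [energy_coercive]. *)
have -> : 0 = \int[lebesgue_measure]_(t in I) (- xi * h t) :> R.
  by rewrite (RintegralZl _ mI ih) int_h mulr0.
apply: (le_Rintegral mI ixih iAB) => t It.
rewrite mulNr -subr_ge0 opprK.
exact: (energy_coercive m (f t) (f1 t) (psi t) (p2 t) (Rc t) (S t) N_gt2 xi_ge0
  xi_le (G_le It)).
Qed.

End EnergyInequality.

Unset Implicit Arguments.
Set Strict Implicit.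
Set Printing Implicit Defensive.

Theorem theorem1 (R : realType) (n : nat) (hn : (3 <= n)%N)
  (M : manifold R n) (g : lorentz_metric M)
  (I : set R) (I_open : open I) (I_interval : is_interval I)
  (gamma : R -> M) (gamma_geodesic : geodesic g I gamma)
  (gamma_proper : proper_time g I gamma)
  (m : R) (m_ge0 : 0 <= m)
  (xi : R) (xi_ge0 : 0 <= xi) (xi_le : xi <= 2 * conformal_coupling R n)
  (phi : M -> R) (phi_smooth : smooth_fun phi)
  (phi_solution : field_solution g m xi phi)
  (f : R -> R) (f_C2 : C2 f) (f_compact : compact (tsupport f))
  (f_supp : tsupport f `<=` I) :
  \int[lebesgue_measure]_(t in I) (eff_density g gamma m xi phi t * f t ^+ 2)
  >= - \int[lebesgue_measure]_(t in I)
         (((1 - 2 * xi) / (n%:R - 2) * m ^+ 2 * f t ^+ 2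
           + xi * (2 * derive1 f t ^+ 2
                   + ricci_along g gamma t * f t ^+ 2
                   - 2 * xi / (n%:R - 2) * scal g (gamma t) * f t ^+ 2))
          * phi (gamma t) ^+ 2).
Proof.
have gamma_smooth := gamma_geodesic.1.
have n_gt2 : 2 < n%:R :> R by rewrite (ltr_nat R 2).
have n_gt0 : (0 < n)%N by exact: leq_trans hn.
have E := energy_inequality I_open I_interval m f_C2 f_compact f_supp
  (field_along_smooth I_open gamma_smooth phi_smooth)
  (grad2_along_continuous (g := g) I_open gamma_smooth phi_smooth)
  (ricci_along_continuous (g := g) I_open gamma_smooth)
  (scal_along_continuous (g := g) I_open gamma_smooth)
  n_gt2 xi_ge0 xi_le
  (fun t It => grad2_along_le I_open gamma_smooth phi_smooth gamma_proper n_gt0 It).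
(* The two integrals compared here are equal: the explicit density in [E] is [eff_density] at every
   time in [I]. *)
apply: (le_trans E); rewrite le_eqVlt; apply/orP; left; apply/eqP.
apply: eq_Rintegral => t /set_mem It; congr (_ * _); apply/esym.
exact: (eff_density_along I_open gamma_smooth phi_smooth gamma_geodesic gamma_proper hn phi_solution It).
Qed.
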